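(* Let $A$ and $B$ be finitely generated residually finite groups, let $G=A\star B$ be their free product, and let $S\subset G$ be a finite generating set of $G$. Assume that $A$ and $B$ each have a box space which coarsely embeds into a Hilbert space. Then $G$ has a faithful sequence of irreducible symmetric representations $(\sigma_n:G\to \mathrm{Sym}(X_n))_n$ such that the coarse disjoint union $\sqcup_n \mathrm{Sch}_S(X_n)$ of the associated Schreier graphs coarsely embeds into a Hilbert space.
   Context: Symmetric representations: an irreducible symmetric representation of $G$ is the homomorphism $G\to\mathrm{Sym}(G/N)$ given by the left action of $G$ on $X=G/N$, where $N\le G$ is a finite index, not necessarily normal, subgroup. A sequence of irreducible symmetric representations, given by finite index subgroups $(N_n)_n$, is faithful if the subgroups $N_n$ have trivial intersection. For a generating set $S$ of $G$ and a $G$-set $X$, the Schreier graph $\mathrm{Sch}_S(X)$ has vertex set $X$ and an edge joining $z$ to $s.z$ for each $z\in X$, $s\in S$; it carries the graph metric. Coarse embedding: a metric space $X$ coarsely embeds into $Y$ if there are a map $F:X\to Y$ and non-decreasing proper functions $\rho_\pm:[0,\infty)\to[0,\infty)$ (proper: tending to infinity at infinity) with $\rho_-(d_X(x,x'))\le d_Y(F(x),F(x'))\le\rho_+(d_X(x,x'))$ for all $x,x'\in X$. Coarse disjoint union: let $d_{\mathrm{f.a}}(n,m)=|2^n-2^m|$ on $\mathbb N$. The coarse disjoint union $\sqcup_nX_n$ of a sequence of metric spaces is the metric space $(X,d)$, unique up to coarse equivalence, such that: (1) there are a map $p:X\to\mathbb N$ and a non-decreasing proper function $\rho:[0,\infty)\to[0,\infty)$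 such that $p^{-1}(n)$ is isometric to $X_n$ for all $n$ and $d_{\mathrm{f.a}}(p(x),p(y))\le\rho(d(x,y))$ for all $x,y$; (2) for all $R>0$ and $n\ne m$, $\{x\in X_n: d(x,X_m)\le R\}$ is bounded. Box space: a proper length on a group $\Gamma$ is a map $\ell:\Gamma\to[0,\infty)$, subadditive, symmetric, vanishing only at $e$, with finite balls. Given a sequence $(N_n)_n$ of finite index normal subgroups of $\Gamma$ with trivial intersection, the associated box space is $\sqcup_n\Gamma/N_n$, where $\Gamma/N_n$ has the metric of the quotient length $\ell(gN_n)=\inf_{h\in N_n}\ell(gh)$ (up to coarse equivalence independent of $\ell$). *)

(* Defs.v *)
From HB Require Import structures.
From mathcomp Require Import all_boot all_order all_algebra sesquilinear.
From mathcomp Require Import all_classical all_reals all_analysis.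

Set Implicit Arguments.
Unset Strict Implicit.
Unset Printing Implicit Defensive.

Import Order.TTheory GRing.Theory Num.Theory.
Import numFieldNormedType.Exports.

Local Open Scope classical_set_scope.
Local Open Scope ring_scope.

Section Groups.
Variable G : groupType.
Implicit Types (S : set G) (N : groupClosed G).

Definition generates S : Prop :=
  forall K : groupClosed G, (forall s, S s -> s \in K) -> forall g, g \in K.

Definition finitely_generated : Prop :=
  exists S : set G, finite_set S /\ generates S.

Definition left_coset N (g : G) : set G := [set (g * h)%g | h in [set` N]].

Definition finite_index N : Prop := finite_set (range (left_coset N)).

Definition normal_subgroup N : Prop :=
  forall g h : G, h \in N -> (h ^ g)%g \in N.

Definition residually_finite : Prop :=
  forall g : G, g <> 1%g ->
    exists N, [/\ normal_subgroup N, finite_index N & g \notin N].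

Definition trivial_intersection (N : nat -> groupClosed G) : Prop :=
  forall g : G, (forall n, g \in N n) -> g = 1%g.

End Groups.

(* The universal property, which determines (G, iA, iB) up to a unique
   isomorphism. *)
Definition is_free_product (A B G : groupType)
    (iA : {multiplicative A -> G}) (iB : {multiplicative B -> G}) : Prop :=
  forall (H : groupType)
      (f : {multiplicative A -> H}) (g : {multiplicative B -> H}),
    exists h : {multiplicative G -> H},
      [/\ forall a, h (iA a) = f a,
          forall b, h (iB b) = g b &
          forall h' : {multiplicative G -> H},
            (forall a, h' (iA a) = f a) -> (forall b, h' (iB b) = g b) ->
            h' =1 h].

(* A homomorphism G -> Sym(X), given as a left action of G on X; each
   [sym_act g] is a permutation, with inverse [sym_act g^-1]. *)
Record symrep (G : groupType) := Symrep {
  sym_space :> Type;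
  sym_act : G -> sym_space -> sym_space;
  sym_act1 : forall x, sym_act 1%g x = x;
  sym_actM : forall g h x, sym_act (g * h)%g x = sym_act g (sym_act h x)
}.

Section IrreducibleSymrep.
Variables (G : groupType) (N : groupClosed G).

Definition cosets : Type := range (left_coset N).

Lemma coset_translate_subproof (g : G) (C : cosets) :
  [set (g * x)%g | x in \val C] \in range (left_coset N).
Proof.
apply/mem_set; have /set_mem[h _ hC] := valP C; exists (g * h)%g => //.
rewrite -hC /left_coset image_comp; apply: eq_imagel => x _ /=.
by rewrite mulgA.
Qed.

Definition coset_act (g : G) (C : cosets) : cosets :=
  exist _ [set (g * x)%g | x in \val C] (coset_translate_subproof g C).

Lemma coset_act1 (C : cosets) : coset_act 1%g C = C.
Proof.
apply: val_inj => /=; under eq_imagel do rewrite mul1g.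
by rewrite image_id.
Qed.

Lemma coset_actM (g h : G) (C : cosets) :
  coset_act (g * h)%g C = coset_act g (coset_act h C).
Proof.
apply: val_inj; rewrite /= image_comp.
by apply: eq_imagel => x _ /=; rewrite mulgA.
Qed.

Definition irr_symrep : symrep G := Symrep coset_act1 coset_actM.

End IrreducibleSymrep.

Section Metric.
Variable R : realType.

(* Functions [0, oo) -> [0, oo) are represented by functions R -> R whose
   values at negative arguments are irrelevant. *)
Definition control_function (rho : R -> R) : Prop :=
  [/\ forall t, 0 <= t -> 0 <= rho t,
      forall s t, 0 <= s -> s <= t -> rho s <= rho t &
      rho t @[t --> +oo] --> +oo].

Definition coarsely_embeds (X Y : Type) (dX : X -> X -> R)
    (dY : Y -> Y -> R) : Prop :=
  exists (F : X -> Y) (rho_m rho_p : R -> R),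
    [/\ control_function rho_m, control_function rho_p &
        forall x x' : X,
          rho_m (dX x x') <= dY (F x) (F x') <= rho_p (dX x x')].

Definition is_hilbert (H : completeNormedModType R) : Prop :=
  exists ip : {dot H for idfun}, forall x : H, `|x| ^+ 2 = ip x x.

Definition embeds_in_hilbert (X : metricType R) : Prop :=
  exists H : completeNormedModType R,
    is_hilbert H /\
    coarsely_embeds (@mdist R X) (fun x y : H => `|x - y|).

Definition metric_bounded (X : metricType R) (U : set X) : Prop :=
  exists M : R, forall x y, U x -> U y -> mdist x y <= M.

(* The n-th metric space of the sequence is given by its points [T n] and its
   distance [d n]; the isometry with a subset of X makes [d n] a metric. *)
Definition coarse_disjoint_union (T : nat -> Type)
    (d : forall n, T n -> T n -> R) (X : metricType R) : Prop :=
  exists p : X -> nat,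
    [/\ forall n, exists f : T n -> X,
          range f = p @^-1` [set n] /\
          forall x y, mdist (f x) (f y) = d n x y,
        exists2 rho : R -> R, control_function rho &
          forall x y : X,
            `|2 ^+ p x - 2 ^+ p y| <= rho (mdist x y) &
        forall (r : R) (n m : nat), 0 < r -> n <> m ->
          metric_bounded [set x | p x = n /\
            (ereal_inf [set (mdist x y)%:E | y in p @^-1` [set m]]
               <= r%:E)%E]].

Definition proper_length (Gam : groupType) (l : Gam -> R) : Prop :=
  [/\ forall g, 0 <= l g,
      forall g h, l (g * h)%g <= l g + l h,
      forall g, l (g^-1)%g = l g,
      forall g, l g = 0 <-> g = 1%g &
      forall r : R, finite_set [set g | l g <= r]].

Definition quotient_length (Gam : groupType) (l : Gam -> R) (C : set Gam) : R :=
  inf [set l g | g in C].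

(* For N normal the set of products below is the coset C^-1 D in Gam / N. *)
Definition quotient_dist (Gam : groupType) (l : Gam -> R)
    (N : groupClosed Gam) (C D : cosets N) : R :=
  quotient_length l [set (x^-1 * y)%g | x in \val C & y in \val D].

Definition is_box_space (Gam : groupType) (X : metricType R) : Prop :=
  exists (N : nat -> groupClosed Gam) (l : Gam -> R),
    [/\ forall n, normal_subgroup (N n),
        forall n, finite_index (N n),
        trivial_intersection N,
        proper_length l &
        coarse_disjoint_union (fun n => @quotient_dist Gam l (N n)) X].

Definition walk (V : Type) (adj : V -> V -> Prop) (k : nat) (x y : V) : Prop :=
  exists v : nat -> V,
    [/\ v 0%N = x, v k = y & forall i, (i < k)%N -> adj (v i) (v i.+1)].

(* The length of a shortest walk; by the convention on [inf] it is 0 between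
   points that no walk joins, which does not happen in a connected graph. *)
Definition graph_dist (V : Type) (adj : V -> V -> Prop) (x y : V) : R :=
  inf [set k%:R | k in [set k | walk adj k x y]].

Definition schreier_adj (G : groupType) (S : set G) (X : symrep G)
    (x y : X) : Prop :=
  exists2 s, S s & y = sym_act s x \/ x = sym_act s y.

Definition schreier_dist (G : groupType) (S : set G) (X : symrep G) :
    X -> X -> R :=
  graph_dist (schreier_adj S (X := X)).

End Metric.

(* Main.v *)
Require Import Defs.
From HB Require Import structures.
From mathcomp Require Import all_boot all_order all_algebra sesquilinear.
From mathcomp Require Import all_classical all_reals all_analysis.
From mathcomp Require Import ring lra zify.

(* Let l_1, ..., l_k be the letters of a reduced word, taken alternately in A
   and B, and let Q_i be the quotient of A or B in the box space in which l_i
   survives. Gluing the exit l_i of Q_i to the entry (the trivial coset) of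
   Q_(i+1) gives a chain of finite quotients on which A and B act: a group acts
   by translation on the pieces of its own colour and fixes all other points.
   By the universal property A * B acts on the chain, and the word moves the
   entry of Q_1 to the exit of Q_k, so it is not in the stabilizer of the entry
   of Q_1. These stabilizers form the faithful sequence.

   A point of the chain is encoded by its coordinates
     (exit_1, ..., exit_(j-1), t, entry_(j+1), ..., entry_k),  t in Q_j,
   so applying the maps of the box spaces coordinatewise gives a map into a sum
   of Hilbert spaces. A letter moves one coordinate only, whence a uniform upper
   bound. For the lower bound, every Q_i is given an extra coordinate that keeps
   its entry at distance at least 1 from its other points: if the images of two
   points are at distance r, then one point is moved to the other by at most
   2 + r^2 letters, taken from a finite set that depends on r only. *)

Set Implicit Arguments.
Unset Strict Implicit.
Unset Printing Implicit Defensive.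

Import Order.TTheory GRing.Theory Num.Theory.
Import numFieldNormedType.Exports.

Local Open Scope classical_set_scope.
Local Open Scope ring_scope.

(** * Square-summable sequences *)

Section InnerProduct.
Variables (R : realType) (V : normedModType R).

(* The norm of V is only required to be equivalent to the one given by the
   inner product: this covers products of Hilbert spaces, which carry the
   maximum norm. *)
Record inner := Inner {
  ip :> V -> V -> R;
  ipDl : forall x y z, ip (x + y) z = ip x z + ip y z;
  ipZl : forall a x y, ip (a *: x) y = a * ip x y;
  ipC : forall x y, ip x y = ip y x;
  ip_lower : forall x, `|x| ^+ 2 <= ip x x;
  ip_upper : exists2 C, 0 <= C & forall x, ip x x <= C * `|x| ^+ 2
}.

Variable q : inner.

Lemma ipDr x y z : q x (y + z) = q x y + q x z.
Proof. by rewrite ipC ipDl !(ipC q _ x). Qed.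

Lemma ipZr a x y : q x (a *: y) = a * q x y.
Proof. by rewrite ipC ipZl ipC. Qed.

Lemma ip_ge0 x : 0 <= q x x.
Proof. exact: le_trans (sqr_ge0 _) (ip_lower q x). Qed.

Lemma ip0 x : q 0 x = 0.
Proof. by rewrite -(scale0r (0 : V)) ipZl mul0r. Qed.

Lemma ipD x y : q (x + y) (x + y) = q x x + q y y + 2 * q x y.
Proof. by rewrite ipDl !ipDr (ipC q y x); ring. Qed.

Lemma ipN x : q (- x) (- x) = q x x.
Proof. by rewrite -scaleN1r ipZl ipZr; ring. Qed.

Lemma ipD_le x y : q (x + y) (x + y) <= 2 * q x x + 2 * q y y.
Proof.
have := ip_ge0 (x - y); rewrite ipD ipN.
have -> : q x (- y) = - q x y by rewrite -scaleN1r ipZr; ring.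
by rewrite ipD; lra.
Qed.

End InnerProduct.

Section SquareSummable.
Variables (R : realType) (V : normedModType R) (q : inner V).

Definition psum (f : nat -> V) (n : nat) : R := \sum_(i < n) q (f i) (f i).

Lemma psum_ge0 f n : 0 <= psum f n.
Proof. by apply: sumr_ge0 => i _; exact: ip_ge0. Qed.

Lemma psum_homo f : {homo psum f : n m / (n <= m)%N >-> n <= m}.
Proof.
apply: homo_leq => [//||n]; first exact: le_trans.
by rewrite /psum big_ord_recr /= lerDl ip_ge0.
Qed.

Lemma psumD f g n : psum (f + g) n <= 2 * psum f n + 2 * psum g n.
Proof.
rewrite /psum !mulr_sumr -big_split /=; apply: ler_sum => i _.
exact: ipD_le.
Qed.

Lemma psumZ a f n : psum (a *: f) n = a ^+ 2 * psum f n.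
Proof.
rewrite /psum mulr_sumr; apply: eq_bigr => i _.
by rewrite fctE ipZl ipZr; ring.
Qed.

Definition sqsummable : {pred nat -> V} :=
  fun f => `[< exists M, forall n, psum f n <= M >].

Lemma sqsummableP f : reflect (exists M, forall n, psum f n <= M)
  (f \in sqsummable).
Proof. exact: asboolP. Qed.

Lemma sqsummable_submod : submod_closed sqsummable.
Proof.
split=> [|a f g /sqsummableP[M hM] /sqsummableP[M' hM']].
  apply/sqsummableP; exists 0 => n; rewrite /psum big1 // => i _.
  exact: ip0.
apply/sqsummableP; exists (2 * (a ^+ 2 * M) + 2 * M') => n.
apply: le_trans (psumD _ _ _) _; rewrite psumZ.
have := hM' n; have : a ^+ 2 * psum f n <= a ^+ 2 * M.
  by rewrite ler_wpM2l ?sqr_ge0.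
by lra.
Qed.

HB.instance Definition _ := GRing.isSubmodClosed.Build R (nat -> V) sqsummable
  sqsummable_submod.

Record l2 := L2 { l2val :> nat -> V; l2valP : l2val \in sqsummable }.

HB.instance Definition _ := [isSub for l2val].
HB.instance Definition _ := [Choice of l2 by <:].
HB.instance Definition _ := [SubChoice_isSubLmodule of l2 by <:].

Implicit Types f g h : l2.

Lemma l2D f g i : (f + g) i = f i + g i.
Proof. by []. Qed.

Lemma l2N f i : (- f) i = - f i.
Proof. by []. Qed.

Definition pip f g (n : nat) : R := \sum_(i < n) q (f i) (g i).

(** Polarization: it derives the convergence of the inner products from that of the monotone bounded
    sums [psum]. *)
Lemma pipE f g n : pip f g n = (psum (f + g : l2) n - psum f n - psum g n) / 2.
Proof.
rewrite /pip /psum -!sumrB mulr_suml; apply: eq_bigr => i _.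
by rewrite l2D ipD; field.
Qed.

Lemma psum_cvg f : cvgn (psum f).
Proof.
have /sqsummableP[M hM] := l2valP f.
apply: nondecreasing_is_cvgn; first exact: psum_homo.
by exists M => _ [n _ <-].
Qed.

Lemma pip_cvg f g : cvgn (pip f g).
Proof.
have -> : pip f g =
  (fun n => (psum (f + g : l2) n - psum f n - psum g n) * 2^-1).
  by apply/funext => n; exact: pipE.
apply: is_cvgM; last exact: is_cvg_cst.
apply: is_cvgB; last exact: psum_cvg.
by apply: is_cvgB; exact: psum_cvg.
Qed.

Definition l2ip f g : R := limn (pip f g).

Lemma l2ipDl f g h : l2ip (f + g) h = l2ip f h + l2ip g h.
Proof.
rewrite /l2ip -limD; [|exact: pip_cvg|exact: pip_cvg].
congr (limn _); apply/funext => n; rewrite /pip fctE -big_split /=.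
by apply: eq_bigr => i _; rewrite ipDl.
Qed.

Lemma l2ipZl a f g : l2ip (a *: f) g = a * l2ip f g.
Proof.
apply: cvg_lim => //.
have -> : pip (a *: f) g = (fun n => a * pip f g n).
  apply/funext => n; rewrite /pip mulr_sumr.
  by apply: eq_bigr => i _; rewrite ipZl.
by apply: cvgM; [exact: cvg_cst|exact: pip_cvg].
Qed.

Lemma l2ipC f g : l2ip f g = l2ip g f.
Proof.
congr (limn _); apply/funext => n.
by apply: eq_bigr => i _; rewrite ipC.
Qed.

Lemma psum_le f n : psum f n <= l2ip f f.
Proof. exact: nondecreasing_cvgn_le (@psum_homo f) (@psum_cvg f) n. Qed.

Lemma l2ip_le f M : (forall n, psum f n <= M) -> l2ip f f <= M.
Proof. by move=> h; apply: limr_le; [exact: psum_cvg|exact: nearW]. Qed.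

Lemma l2ip_coord f i : q (f i) (f i) <= l2ip f f.
Proof.
apply: le_trans (psum_le f i.+1); rewrite /psum big_ord_recr /= lerDr.
exact: psum_ge0.
Qed.

Lemma l2ip_ge0 f : 0 <= l2ip f f.
Proof. exact: le_trans (psum_ge0 f 0) (psum_le f 0). Qed.

Lemma l2ip_eq0 f : l2ip f f = 0 -> f = 0.
Proof.
move=> f0; apply: val_inj; apply/funext => i /=.
apply/eqP; rewrite -normr_eq0 -sqrf_eq0 eq_le sqr_ge0 andbT.
by rewrite -f0 (le_trans (ip_lower q _)) ?l2ip_coord.
Qed.

Lemma l2ipD f g : l2ip (f + g) (f + g) = l2ip f f + l2ip g g + 2 * l2ip f g.
Proof. by rewrite l2ipDl !(l2ipC _ (f + g)) !l2ipDl (l2ipC g f); ring. Qed.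

Lemma l2_cauchy_schwarz f g : l2ip f g ^+ 2 <= l2ip f f * l2ip g g.
Proof.
have [g0|g0] := eqVneq (l2ip g g) 0.
  rewrite (l2ip_eq0 g0) l2ipC.
  have -> : l2ip 0 f = 0 by rewrite -(scale0r (0 : l2)) l2ipZl mul0r.
  by rewrite expr0n /= mulr_ge0 ?l2ip_ge0.
have gp : 0 < l2ip g g by rewrite lt_def g0 l2ip_ge0.
(* [f] minus its orthogonal projection onto [g] has nonnegative square; multiplied by [l2ip g g],
   this is the inequality. *)
have := l2ip_ge0 (f + (- l2ip f g / l2ip g g) *: g).
rewrite l2ipD l2ipZl (l2ipC f (_ *: _)) (l2ipC g (_ *: _)) !l2ipZl (l2ipC g f).
rewrite -(pmulr_lge0 _ gp).
set a := l2ip f f; set b := l2ip f g; set c := l2ip g g.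
suff -> : (a + - b / c * (- b / c * c) + 2 * (- b / c * b)) * c
  = a * c - b ^+ 2 by rewrite subr_ge0.
by field.
Qed.

Definition l2norm f : R := Num.sqrt (l2ip f f).

Lemma l2normD f g : l2norm (f + g) <= l2norm f + l2norm g.
Proof.
rewrite -[leRHS]ger0_norm ?addr_ge0 ?sqrtr_ge0 // -sqrtr_sqr.
rewrite ler_wsqrtr // sqrrD !sqr_sqrtr ?l2ip_ge0 // l2ipD.
have := l2_cauchy_schwarz f g => /ler_wsqrtr.
rewrite sqrtr_sqr sqrtrM ?l2ip_ge0 // => /(le_trans (ler_norm _)).
by rewrite /l2norm; lra.
Qed.

Lemma l2normZ a f : l2norm (a *: f) = `|a| * l2norm f.
Proof.
rewrite /l2norm l2ipZl l2ipC l2ipZl mulrA -expr2 sqrtrM ?sqr_ge0 //.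
by rewrite sqrtr_sqr.
Qed.

Lemma l2norm_eq0 f : l2norm f = 0 -> f = 0.
Proof.
move=> /eqP; rewrite sqrtr_eq0 => h; apply: l2ip_eq0.
by apply/eqP; rewrite eq_le h l2ip_ge0.
Qed.

HB.instance Definition _ := Lmodule_isNormed.Build R l2 l2normD l2normZ
  l2norm_eq0.

Lemma l2_normE f : `|f| ^+ 2 = l2ip f f.
Proof. by rewrite sqr_sqrtr ?l2ip_ge0. Qed.

Lemma l2_norm_coord f i : `|f i| <= `|f|.
Proof.
rewrite -(@ler_pXn2r _ 2) ?nnegrE ?normr_ge0 // l2_normE.
exact: le_trans (ip_lower q _) (l2ip_coord f i).
Qed.

(** * Completeness of the space of square-summable sequences *)

Hypothesis V_complete : forall F : set_system V, ProperFilter F ->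
  cauchy F -> cvg F.

(** The limit is taken coordinatewise. Its square-summability and the convergence in norm both
    follow from [key], which bounds partial sums independently of their length. *)
Lemma l2_complete (F : set_system l2) : ProperFilter F -> cauchy F -> cvg F.
Proof.
move=> PF cF.
have cF' : cauchy_ex F by apply/cauchyP.
have coord_cvg i : cvg ((fun f : l2 => f i) @ F).
  apply: V_complete; apply: cauchy_exP => e e0.
  have [f hf] := cF' e e0; exists (f i); rewrite /fmap /=.
  apply: filterS hf => h; rewrite -!ball_normE /=.
  exact: le_lt_trans (l2_norm_coord (f - h) i).
pose g i := lim ((fun f : l2 => f i) @ F).
have [C C0 hC] := ip_upper q.
have close (N : nat) (e : R) : 0 < e ->
    F [set h : l2 | psum (fun i => h i - g i) N <= e].
  move=> e0; elim: N => [|N IH] in e e0 *.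
    by apply: filterE => h /=; rewrite /psum big_ord0 ltW.
  (* [C + 1] instead of [C] keeps the denominator positive when [C = 0]. *)
  have [d d0 hd] : exists2 d, 0 < d & C * d ^+ 2 <= e / 2.
    exists (Num.sqrt (e / 2 / (C + 1))).
      by rewrite sqrtr_gt0 !divr_gt0 // ltr_pwDr.
    rewrite sqr_sqrtr; last by rewrite !divr_ge0 // ?ltW // ltr_pwDr.
    rewrite mulrCA -[leRHS]mulr1 ler_wpM2l //; first by rewrite divr_ge0 // ltW.
    by rewrite ler_pdivrMr ?ltr_pwDr // mul1r lerDl.
  have FN : F [set h : l2 | `|g N - h N| < d].
    by move/cvgrPdist_lt: (coord_cvg N) => /(_ _ d0).
  have e20 : 0 < e / 2 by rewrite divr_gt0.
  apply: filterS (filterI (IH _ e20) FN) => h [/= h1 h2].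
  rewrite /psum big_ord_recr /= [leRHS]splitr lerD //.
  apply: le_trans (hC _) (le_trans _ hd); rewrite ler_wpM2l //.
  by rewrite distrC ler_pXn2r ?nnegrE // ltW.
(* A point [h] of [ball f e] that is close to [g] on the first [N] coordinates is inserted between
   [f] and [g]; [h] depends on [N], the bound does not. *)
have key (e : R) (f : l2) : 0 < e -> F (ball f e) ->
    forall N, psum (fun i => f i - g i) N <= 2 * e ^+ 2 + 2 * e ^+ 2.
  move=> e0 Ff N; have e20 : 0 < e ^+ 2 by rewrite exprn_gt0.
  have [h [/= h1 h2]] := filter_ex (filterI Ff (close N _ e20)).
  have -> : (fun i => f i - g i) = l2val (f - h) + (fun i => h i - g i).
    by apply/funext => i; rewrite fctE /= subrKA.
  apply: le_trans (psumD _ _ _) _; rewrite lerD ?ler_wpM2l //.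
  apply: le_trans (psum_le _ _) _; rewrite -l2_normE.
  by move: h1; rewrite -ball_normE /= => ?; rewrite ler_pXn2r ?nnegrE ?normr_ge0 ?ltW.
have g2 : g \in sqsummable.
  have [f Ff] := cF' 1 ltr01.
  have -> : g = (f : nat -> V) - (fun i => f i - g i).
    by apply/funext => i; rewrite !fctE subKr.
  apply: rpredB; first exact: l2valP.
  by apply/sqsummableP; exists (2 * 1 ^+ 2 + 2 * 1 ^+ 2); exact: key.
apply/cvg_ex; exists (L2 g2); apply/cvgrPdist_le => e e0.
(* With radius [e / 4], [key] bounds the squared norm by [4 (e / 4)^2 = (e / 2)^2]. *)
have e20 : 0 < e / 4 by rewrite divr_gt0.
have e40 : 0 < e / 2 by rewrite divr_gt0.
have [f Ff] := cF' _ e20.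
have fg : `|L2 g2 - f| <= e / 2.
  rewrite distrC -(@ler_pXn2r _ 2) ?nnegrE ?normr_ge0 ?(ltW e40) // l2_normE.
  apply: l2ip_le => n; apply: le_trans (key _ _ e20 Ff n) _.
  by rewrite le_eqVlt; apply/orP; left; apply/eqP; field.
apply: filterS Ff => h; rewrite -ball_normE /= => fh.
rewrite -(subrKA f) (le_trans (ler_normD _ _)) // [leRHS]splitr lerD //.
by apply: le_trans (ltW fh) _; rewrite ler_pM2l // lef_pV2 ?posrE // ler_nat.
Qed.

Definition l2inner : inner l2.
Proof.
exists l2ip; [exact: l2ipDl|exact: l2ipZl|exact: l2ipC| |].
  by move=> f; rewrite l2_normE.
by exists 1 => // f; rewrite l2_normE mul1r.
Defined.

End SquareSummable.

(** * Chains of pieces *)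

Section Chain.
Variables (R : realType) (V : normedModType R) (q : inner V).
Variables (T : eqType) (L : Type) (col : L -> bool) (linv : L -> L).
Variable lact : L -> T -> T.
Hypothesis col_linv : forall l, col (linv l) = col l.
Hypothesis lactK : forall l, cancel (lact l) (lact (linv l)).

(** All pieces have their points in one type [T], with [pset] the points that occur, so that a point
    of a chain is a plain sequence over [T]. *)
Record piece := Piece {
  pcol : bool;
  pentry : T;
  pexit : T;
  pset : set T;
  pmap : T -> V
}.
Implicit Types (p : piece) (w : seq piece) (x y : seq T).

Definition base w := map pentry w.

(** A point of the chain lies in the first piece exactly when its later coordinates are entries. The
    exit of that piece followed by entries is a gluing point: it lies in two pieces, and each colour
    acts in its own. The laws below hold on all sequences, not only on points of the chain. *)
Fixpoint chain_act w (l : L) x : seq T :=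
  match w, x with
  | p :: w', t :: x' =>
    if (pcol p == col l) && (x' == base w') then lact l t :: x'
    else if t == pexit p then t :: chain_act w' l x' else x
  | _, _ => x
  end.

Definition head_color w : option bool :=
  if w is p :: _ then Some (pcol p) else None.

Fixpoint alternating w : bool :=
  if w is p :: w' then
    [&& pexit p != pentry p, head_color w' != Some (pcol p) & alternating w']
  else true.

(** As its entry is not its exit, the base point lies in the first piece only, so a letter of the
    other colour fixes it. *)
Lemma chain_act_base w l : alternating w -> head_color w != Some (col l) ->
  chain_act w l (base w) = base w.
Proof.
case: w => [//|p w] /= /and3P[ep _ _].
rewrite -[Some _ != _]/(pcol p != col l) => /negbTE ->.
by rewrite /= eq_sym (negbTE ep).
Qed.

Lemma chain_actK w l : alternating w ->
  cancel (chain_act w l) (chain_act w (linv l)).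
Proof.
elim: w => [//|p w IH] /and3P[ep hw aw] [//|t x] /=.
case: ifP => [/andP[pl xb]|h1] /=.
  by rewrite col_linv pl xb lactK.
case: ifP => [te|h2] /=; last by rewrite col_linv h1 h2.
rewrite col_linv te IH //; case: ifP => // /andP[pl /eqP xb].
(* Letters of the colour of [p] fix the base point of [w]. A step in the tail that ends there
   therefore also started there, which [h1] excludes. *)
have : x = base w.
  rewrite -(IH aw x) xb chain_act_base //.
  by rewrite col_linv -(eqP pl).
by move=> e; rewrite pl e eqxx in h1.
Qed.

(** Yields the homomorphism law for each factor. As for inverses, the delicate case is a tail
    arriving at its base point by a letter of the colour of [p], which alternation rules out. *)
Lemma chain_act_comp w l l' l'' : alternating w -> col l = col l'' ->
    col l' = col l'' -> (forall t, lact l'' t = lact l (lact l' t)) ->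
  forall x, chain_act w l'' x = chain_act w l (chain_act w l' x).
Proof.
move=> + cl cl' ll; elim: w => [//|p w IH] /and3P[ep hw aw] [//|t x] /=.
rewrite cl'; case: ifP => [/andP[pl xb]|h1] /=.
  by rewrite cl pl xb ll.
case: ifP => [te|h2] /=; last by rewrite cl h1 h2.
rewrite te cl IH //; case: ifP => // /andP[pl /eqP xb].
have : x = base w.
  rewrite -(chain_actK l' aw x) xb chain_act_base //.
  by rewrite col_linv cl' -(eqP pl).
by move=> e; rewrite pl e eqxx in h1.
Qed.

(** Gluing is built into the coordinates: the exit of a piece and the entry of the next one are the
    same sequence, which satisfies both alternatives when the pieces are closed. *)
Fixpoint chain w x : Prop :=
  match w, x with
  | p :: w', t :: x' => (pset p t /\ x' = base w') \/ (t = pexit p /\ chain w' x')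
  | [::], [::] => True
  | _, _ => False
  end.

Definition piece_closed p := [/\ pset p (pentry p), pset p (pexit p) &
  forall l t, col l = pcol p -> pset p t -> pset p (lact l t)].

Lemma base_chain w : List.Forall piece_closed w -> chain w (base w).
Proof. by case: w => //= p w h; have [p0 _ _] := List.Forall_inv h; left. Qed.

Lemma chain_act_chain w l x : alternating w -> List.Forall piece_closed w ->
  chain w x -> chain w (chain_act w l x).
Proof.
elim: w x => [|p w IH] [|t x] //= /and3P[ep hw aw] cw.
have [p0 pe pl] := List.Forall_inv cw.
have cw' := List.Forall_inv_tail cw.
case: ifP => [/andP[/eqP pcl /eqP ->]|h1].
  case=> [[h _]|[-> _]]; left; split=> //; exact: pl.
case=> [[h xb]|[-> cx]].
  rewrite xb eqxx andbT in h1; case: ifP => [/eqP te|_]; last by left.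
  by right; split=> //; rewrite xb; apply: IH => //; exact: base_chain.
by rewrite eqxx; right; split => //; exact: IH.
Qed.

Lemma chain_finite w : (forall p, List.In p w -> finite_set (pset p)) ->
  finite_set [set x | chain w x].
Proof.
elim: w => [|p w IH] fw.
  by apply: (@sub_finite_set _ _ [set [::]]) => // -[].
apply: (@sub_finite_set _ _
    ([set t :: base w | t in pset p] `|`
     [set pexit p :: x | x in [set x | chain w x]])).
  by move=> [//|t x] /= [[h ->]|[-> h]]; [left; exists t|right; exists x].
rewrite finite_setU; split; apply: finite_image; first by apply: fw; left.
by apply: IH => p' h; apply: fw; right.
Qed.

Lemma chain_act_exits w1 p w2 l : alternating (w1 ++ p :: w2) ->
    col l = pcol p -> lact l (pentry p) = pexit p ->
  chain_act (w1 ++ p :: w2) l (map pexit w1 ++ base (p :: w2)) =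
  map pexit w1 ++ pexit p :: base w2.
Proof.
move=> aw cl ll; elim: w1 aw => [|p' w1 IH] /=.
  by move=> _; rewrite cl !eqxx /= ll.
(* An earlier piece of the colour of [l] would have to intercept the letter. If it is adjacent to
   [p], it has the other colour; otherwise the next piece stands at its exit, not at its entry. *)
move=> /and3P[ep' hw aw]; rewrite eqxx IH //; case: ifP => // /andP[/eqP pl].
have {IH} : base (w1 ++ p :: w2) = base w1 ++ base (p :: w2).
  by rewrite /base map_cat.
move: hw aw; case: w1 => [|p1 w1] /=.
  by rewrite pl -cl eqxx.
by move=> _ /and3P[e1 _ _] _ /eqP[h]; rewrite h eqxx in e1.
Qed.

(** * Coordinatewise maps of chains to square-summable sequences *)

Definition lcons (v : V) (f : nat -> V) : nat -> V :=
  fun i => if i is j.+1 then f j else v.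

Lemma psum_lcons v f n : psum q (lcons v f) n.+1 = q v v + psum q f n.
Proof. by rewrite /psum big_ord_recl. Qed.

Lemma lcons_sqsummable v (f : l2 q) : lcons v f \in sqsummable q.
Proof.
apply/sqsummableP; exists (q v v + l2ip f f) => -[|n].
  by rewrite /psum big_ord0 addr_ge0 ?ip_ge0 ?l2ip_ge0.
by rewrite psum_lcons lerD2l psum_le.
Qed.

Definition l2cons v f : l2 q := L2 (lcons_sqsummable v f).

Lemma l2consB v f v' f' : l2cons v f - l2cons v' f' = l2cons (v - v') (f - f').
Proof. by apply: val_inj; apply/funext => -[]. Qed.

Lemma l2cons_norm v f : `|l2cons v f| ^+ 2 = q v v + `|f| ^+ 2.
Proof.
rewrite !l2_normE; apply/eqP; rewrite eq_le; apply/andP; split.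
  apply: l2ip_le => -[|n].
    by rewrite /psum big_ord0 addr_ge0 ?ip_ge0 ?l2ip_ge0.
  by rewrite psum_lcons lerD2l psum_le.
rewrite addrC -lerBrDr; apply: l2ip_le => n.
by rewrite lerBrDr addrC -psum_lcons (psum_le (l2cons v f)).
Qed.

Fixpoint chain_map w x : l2 q :=
  match w, x with
  | p :: w', t :: x' => l2cons (pmap p t) (chain_map w' x')
  | _, _ => 0
  end.

(** Squared distances add up over the coordinates, which suits inductions along the chain. *)
Definition sqd w x y : R := `|chain_map w x - chain_map w y| ^+ 2.

Definition psqd p t t' : R := q (pmap p t - pmap p t') (pmap p t - pmap p t').

Lemma sqd_cons p w t x t' x' :
  sqd (p :: w) (t :: x) (t' :: x') = psqd p t t' + sqd w x x'.
Proof. by rewrite /sqd /= l2consB l2cons_norm. Qed.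

Lemma sqdxx w x : sqd w x x = 0.
Proof. by rewrite /sqd subrr normr0 expr0n. Qed.

Lemma sqd_ge0 w x y : 0 <= sqd w x y.
Proof. exact: sqr_ge0. Qed.

Lemma psqdxx p t : psqd p t t = 0.
Proof. by rewrite /psqd subrr ip0. Qed.

Lemma psqd_ge0 p t t' : 0 <= psqd p t t'.
Proof. exact: ip_ge0. Qed.

Lemma sqdC w x y : sqd w x y = sqd w y x.
Proof. by rewrite /sqd distrC. Qed.

Lemma psqdC p t t' : psqd p t t' = psqd p t' t.
Proof. by rewrite /psqd -opprB ipN. Qed.

(** * Uniform upper and lower bounds for the maps of chains *)

Variable beta : L -> R.
Variable E : R -> set L.
Hypothesis beta_ge0 : forall l, 0 <= beta l.

(** [beta] and [E] are fixed before the piece, so the bounds derived from this record are uniform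
    over all chains. *)
Record piece_good p : Prop := PieceGood {
  pgood_closed : piece_closed p;
  pgood_finite : finite_set (pset p);
  pgood_upper : forall l t, col l = pcol p -> pset p t ->
    psqd p (lact l t) t <= beta l;
  pgood_lower : forall r t t', pset p t -> pset p t' -> psqd p t t' <= r ->
    exists l, [/\ E r l, col l = pcol p & t' = lact l t];
  pgood_entry : forall t, pset p t -> t != pentry p -> 1 <= psqd p t (pentry p)
}.

Lemma good_closed w : List.Forall piece_good w -> List.Forall piece_closed w.
Proof. by apply: List.Forall_impl => p []. Qed.

Lemma chain_upper w l x : List.Forall piece_good w ->
  chain w x -> sqd w (chain_act w l x) x <= beta l.
Proof.
elim: w x => [|p w IH] [|t x] //= gw; first by rewrite sqdxx.
have gp := List.Forall_inv gw; have gw' := List.Forall_inv_tail gw.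
move=> cx; case: ifP => [/andP[/eqP pl /eqP xb]|h1].
  rewrite sqd_cons sqdxx addr0; apply: pgood_upper => //.
  by have [_ pe _] := pgood_closed gp; case: cx => -[] // ->.
case: ifP => [/eqP te|h2]; last by rewrite sqdxx.
rewrite sqd_cons psqdxx add0r; apply: IH => //.
by case: cx => -[_] // ->; exact/base_chain/good_closed.
Qed.

(** [n] bounds the number of letters from above: [reach0] holds for every [n]. *)
Inductive reach (D : set L) w : nat -> seq T -> seq T -> Prop :=
| reach0 n x : reach D w n x x
| reachS n x y l : reach D w n x y -> D l ->
    reach D w n.+1 x (chain_act w l y).

Lemma reach_leq D w n m x y : (n <= m)%N -> reach D w n x y -> reach D w m x y.
Proof.
move=> nm r; elim: r m nm => [{}n x' m _|n' x' y' l _ IH Dl [//|m] nm].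
  exact: reach0.
by apply: reachS => //; exact: IH.
Qed.

Lemma reach_trans D w n m x y z :
  reach D w n x y -> reach D w m y z -> reach D w (n + m) x z.
Proof.
move=> rxy ryz; elim: ryz rxy => [{}m {}y|{}m {}y {}z l _ IH Dl] rxy.
  by apply: reach_leq rxy; rewrite leq_addr.
by rewrite addnS; apply: reachS => //; exact: IH.
Qed.

(* A step at the base point of w by a letter of the colour of p would move the
   exit of p instead, but such a step is trivial in the chain of w. *)
Lemma reach_cons D p w n x y : alternating (p :: w) -> reach D w n x y ->
  reach D (p :: w) n (pexit p :: x) (pexit p :: y).
Proof.
move=> /= /and3P[ep hw aw]; elim=> [{}n {}x|{}n {}x {}y l _ IH Dl].
  exact: reach0.
have [/andP[/eqP pl /eqP yb]|h] := boolP ((pcol p == col l) && (y == base w)).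
  by rewrite yb chain_act_base -?pl // -yb; apply: reach_leq IH.
have := reachS IH Dl; rewrite /= (negbTE h) eqxx; exact.
Qed.

Lemma reach_piece r p w t t' : piece_good p -> pset p t -> pset p t' ->
  psqd p t t' <= r -> reach (E r) (p :: w) 1 (t :: base w) (t' :: base w).
Proof.
move=> gp pt pt' /(pgood_lower gp pt pt')[l [El cl ->]].
have := reachS (reach0 (E r) (p :: w) 0 (t :: base w)) El.
by rewrite /= cl !eqxx.
Qed.

(** On the way from [x] to the base point, each exit left behind costs one letter and accounts for
    at least 1 in the squared distance, by [pgood_entry]; the leading 1 pays for the move in the
    piece that contains [x]. Both directions are kept because [E r] is not assumed symmetric. *)
Lemma chain_lower_base r w x : alternating w -> List.Forall piece_good w ->
  chain w x -> sqd w x (base w) <= r ->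
  exists n, [/\ n%:R <= 1 + sqd w x (base w), reach (E r) w n x (base w) &
    reach (E r) w n (base w) x].
Proof.
elim: w x => [|p w IH] [|t x] //=.
  by move=> *; exists 0; rewrite sqdxx; split; [rewrite addr0|exact: reach0..].
move=> aw' gw cx; have /and3P[ep hw aw] := aw'.
have gp := List.Forall_inv gw; have gw' := List.Forall_inv_tail gw.
have [p0 pe _] := pgood_closed gp.
rewrite sqd_cons; case: cx => [[pt ->]|[-> cx]].
  rewrite sqdxx addr0 => h; exists 1%N; split.
  - by rewrite lerDl psqd_ge0.
  - exact: reach_piece.
  - by apply: reach_piece => //; rewrite psqdC.
move=> h; have s0 := sqd_ge0 w x (base w); have p00 := psqd_ge0 p (pexit p) (pentry p).
have [|n [hn r1 r2]] := IH x aw gw' cx; first by lra.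
have e1 := pgood_entry gp pe ep.
have hp : psqd p (pexit p) (pentry p) <= r by lra.
exists (n + 1)%N; split; first by rewrite natrD; lra.
- by apply: reach_trans (reach_cons aw' r1) _; exact: reach_piece.
- rewrite addnC; apply: reach_trans (reach_cons aw' r2).
  by apply: reach_piece => //; rewrite psqdC.
Qed.

(** Once the common exits are stripped off, one of the points lies in the first remaining piece. If
    the other lies beyond, it is joined to the exit of that piece by [chain_lower_base], and one
    more letter joins the two inside the piece, whence 2 instead of 1. *)
Lemma chain_lower r w x y : alternating w -> List.Forall piece_good w ->
  chain w x -> chain w y -> sqd w x y <= r ->
  exists2 n, n%:R <= 2 + sqd w x y & reach (E r) w n x y.
Proof.
elim: w x y => [|p w IH] [|t x] [|t' y] //=.
  by move=> *; exists 0; [rewrite sqdxx addr0|exact: reach0].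
move=> aw' gw cx cy; have /and3P[ep hw aw] := aw'.
have gp := List.Forall_inv gw; have gw' := List.Forall_inv_tail gw.
have [p0 pe _] := pgood_closed gp.
rewrite sqd_cons => h; have s0 := sqd_ge0 w x y; have p00 := psqd_ge0 p t t'.
have hs : sqd w x y <= r by lra.
have hp : psqd p t t' <= r by lra.
case: cx cy h s0 p00 hs hp => [[pt ->]|[-> cx]] [[pt' ->]|[-> cy]] h s0 p00 hs hp.
- by exists 1%N; [lra|exact: reach_piece].
- have [|n [hn _ r2]] := chain_lower_base aw gw' cy (r := r); first by rewrite sqdC.
  exists (1 + n)%N; first by rewrite natrD; move: hn; rewrite sqdC; lra.
  by apply: reach_trans (reach_cons aw' r2); exact: reach_piece.
- have [//|n [hn r1 _]] := chain_lower_base aw gw' cx (r := r).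
  exists (n + 1)%N; first by rewrite natrD; lra.
  by apply: reach_trans (reach_cons aw' r1) _; exact: reach_piece.
- have [//|n hn rn] := IH x y aw gw' cx cy.
  by exists n; [lra|exact: reach_cons].
Qed.

End Chain.

(** * Free products *)

Section Bijections.
Variable T : Type.

(** The permutations of [T] form the group to which the universal property is applied. The inverse
    is carried as data; by [bijection_eq] it adds no freedom. *)
Record bijection := Bijection {
  bij_fun :> T -> T;
  bij_inv : T -> T;
  bij_funK : cancel bij_fun bij_inv;
  bij_invK : cancel bij_inv bij_fun
}.

HB.instance Definition _ := gen_eqMixin bijection.
HB.instance Definition _ := gen_choiceMixin bijection.

Lemma bijection_eq (f g : bijection) : f =1 g -> f = g.
Proof.
case: f g => [f f' fK fK'] [g g' gK gK'] /= /funext fg.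
case: _ / fg in gK gK' *.
have fg' : f' = g' by apply/funext => x; rewrite -{1}(gK' x) fK.
case: _ / fg' in gK gK' *.
by rewrite (Prop_irrelevance fK gK) (Prop_irrelevance fK' gK').
Qed.

Definition bij_one := @Bijection id id (@frefl _ _ id) (@frefl _ _ id).

Definition bij_mul (f g : bijection) := Bijection
  (can_comp (bij_funK f) (bij_funK g)) (can_comp (bij_invK g) (bij_invK f)).

Definition bij_inverse (f : bijection) := Bijection (bij_invK f) (bij_funK f).

Lemma bij_mulA : associative bij_mul.
Proof. by move=> f g h; exact: bijection_eq. Qed.

Lemma bij_mul1 : left_id bij_one bij_mul.
Proof. by move=> f; exact: bijection_eq. Qed.

Lemma bij_mulr1 : right_id bij_one bij_mul.
Proof. by move=> f; exact: bijection_eq. Qed.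

Lemma bij_mulV : left_inverse bij_one bij_inverse bij_mul.
Proof. by move=> f; apply: bijection_eq => x /=; rewrite bij_funK. Qed.

Lemma bij_mulrV : right_inverse bij_one bij_inverse bij_mul.
Proof. by move=> f; apply: bijection_eq => x /=; rewrite bij_invK. Qed.

HB.instance Definition _ := isGroup.Build bijection
  bij_mulA bij_mul1 bij_mulr1 bij_mulV bij_mulrV.

End Bijections.

(** * Homomorphisms and subgroups *)

Section MultiplicativeMaps.
Variables (G H : groupType) (f : {multiplicative G -> H}).

Lemma multiplicative1 : f 1%g = 1%g.
Proof. by apply: (mulgI (f 1%g)); rewrite -gmulfM !mulg1. Qed.

Lemma multiplicativeV x : f (x^-1)%g = ((f x)^-1)%g.
Proof. by apply: (mulgI (f x)); rewrite -gmulfM !mulgV multiplicative1. Qed.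

End MultiplicativeMaps.

Section Subgroup.
Variables (G : groupType) (K : groupClosed G).

Record subgroup := Subgroup { subgroup_val :> G; subgroup_valP : subgroup_val \in K }.

HB.instance Definition _ := [isSub for subgroup_val].
HB.instance Definition _ := [Choice of subgroup by <:].

Lemma subgroup_closed : group_closed K.
Proof. by split; [exact: gpred1|move=> x y; exact: gpredF]. Qed.

HB.instance Definition _ :=
  SubChoice_isSubGroup.Build G _ subgroup subgroup_closed.

End Subgroup.

Section SubgroupOf.
Variables (G : groupType) (P : G -> Prop).
Hypotheses (P1 : P 1%g) (PM : forall x y, P x -> P y -> P (x * y)%g).
Hypothesis PV : forall x, P x -> P (x^-1)%g.

Definition subgroup_pred : {pred G} := fun x => `[< P x >].

Lemma subgroup_predV : invg_closed subgroup_pred.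
Proof. by move=> x /asboolP h; apply/asboolP/PV. Qed.

Lemma subgroup_pred1 : 1%g \in subgroup_pred.
Proof. exact/asboolP. Qed.

Lemma subgroup_predM : mulg_closed subgroup_pred.
Proof. by move=> x y /asboolP hx /asboolP hy; apply/asboolP/PM. Qed.

Definition subgroup_of : groupClosed G :=
  HB.pack_for (groupClosed G) subgroup_pred
    (isInvClosed.Build G _ subgroup_predV) (isMul1Closed.Build G _ subgroup_pred1)
    (isMulClosed.Build G _ subgroup_predM).

Lemma subgroup_ofP x : reflect (P x) (x \in subgroup_of).
Proof. exact: asboolP. Qed.

End SubgroupOf.

(** * Generation by the two factors, reduced words and actions *)

Section FreeProduct.
Variables (A B G : groupType).
Variables (iA : {multiplicative A -> G}) (iB : {multiplicative B -> G}).
Hypothesis hG : is_free_product iA iB.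

Section Generation.
Variable K : groupClosed G.
Hypotheses (KA : forall a, iA a \in K) (KB : forall b, iB b \in K).

Definition corestrictA (a : A) : subgroup K := Subgroup (KA a).
Definition corestrictB (b : B) : subgroup K := Subgroup (KB b).

Lemma corestrictA_mul : {morph corestrictA : x y / (x * y)%g}.
Proof. by move=> x y; apply: val_inj; rewrite /= gmulfM. Qed.

Lemma corestrictB_mul : {morph corestrictB : x y / (x * y)%g}.
Proof. by move=> x y; apply: val_inj; rewrite /= gmulfM. Qed.

HB.instance Definition _ := isMultiplicative.Build A (subgroup K) corestrictA
  corestrictA_mul.
HB.instance Definition _ := isMultiplicative.Build B (subgroup K) corestrictB
  corestrictB_mul.

(** The maps of the factors to [K] extend to [G]. Followed by the inclusion of [K], the extension is
    an endomorphism of [G] that agrees with the identity on both factors, hence is the identity by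
    uniqueness. *)
Lemma free_product_generated g : g \in K.
Proof.
have [h [hA hB _]] := hG corestrictA corestrictB.
have [k [_ _ ku]] := hG iA iB.
pose v : {multiplicative subgroup K -> G} := val.
have idk : g = k g by exact: (ku idfun).
have vhk : v (h g) = k g.
  by apply: (ku [the {multiplicative G -> G} of v \o h]) => x /=; rewrite ?hA ?hB.
rewrite idk -vhk.
exact: subgroup_valP.
Qed.

End Generation.

Lemma free_product_ind (P : G -> Prop) : P 1%g ->
    (forall g a, P g -> P (g * iA a)%g) -> (forall g b, P g -> P (g * iB b)%g) ->
  forall g, P g.
Proof.
move=> P1 PA PB g.
(* The [k] such that right multiplication by [k] and by its inverse preserves [P] form a subgroup
   containing both factors, hence all of [G]. *)
pose Q (k : G) := (forall g, P g -> P (g * k)%g) /\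
  (forall g, P g -> P (g * k^-1)%g).
have Q1 : Q 1%g by split=> x; rewrite ?invg1 mulg1.
have QM x y : Q x -> Q y -> Q (x * y)%g.
  move=> [h1 h2] [k1 k2]; split=> z Pz; first by rewrite mulgA; auto.
  by rewrite invgM mulgA; auto.
have QV x : Q x -> Q (x^-1)%g by case=> h1 h2; split=> z; rewrite ?invgK; auto.
have QA a : iA a \in subgroup_of Q1 QM QV.
  apply/subgroup_ofP; split=> z Pz; first exact: PA.
  by rewrite -multiplicativeV; exact: PA.
have QB b : iB b \in subgroup_of Q1 QM QV.
  apply/subgroup_ofP; split=> z Pz; first exact: PB.
  by rewrite -multiplicativeV; exact: PB.
have /subgroup_ofP[h _] := free_product_generated QA QB g.
by rewrite -(mul1g g); exact: h.
Qed.

Definition letter := (A + B)%type.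

Definition color (l : letter) : bool := if l is inl _ then true else false.

Definition letter_inv (l : letter) : letter :=
  match l with inl a => inl (a^-1)%g | inr b => inr (b^-1)%g end.

Definition letter_val (l : letter) : G :=
  match l with inl a => iA a | inr b => iB b end.

Definition nontrivial (l : letter) : bool :=
  match l with inl a => a != 1%g | inr b => b != 1%g end.

(* The letter at the head of a word is the rightmost factor of its value, so
   that it acts first. *)
Definition word_val (w : seq letter) : G :=
  foldr (fun l g => g * letter_val l)%g 1%g w.

Fixpoint reduced (w : seq letter) : bool :=
  if w is l :: w' then
    [&& nontrivial l, (if w' is l' :: _ then color l' != color l else true)
      & reduced w']
  else true.

(** A trivial letter is dropped, a letter of the other colour becomes the head, and one of the same
    colour is multiplied into the head, which disappears if the product is trivial. *)
Lemma reduced_mul w l : reduced w ->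
  exists2 w', reduced w' & word_val w' = (word_val w * letter_val l)%g.
Proof.
move=> rw; have [nl|] := boolP (nontrivial l); last first.
  move=> tl; exists w => //.
  by case: l tl => x /=; rewrite negbK => /eqP ->; rewrite multiplicative1 mulg1.
case: w rw => [|l1 w] rw; first by exists [:: l]; rewrite /= ?nl.
have [/= c|c] := boolP (color l1 != color l).
  by exists (l :: l1 :: w); rewrite //= nl c.
move: rw c => /= /and3P[n1 h1 rw].
case: l nl => x nx; case: l1 n1 h1 => y ny h1 //= _.
- have [/eqP yx|yx] := eqVneq (y * x)%g 1%g; last first.
    by exists (inl (y * x)%g :: w); rewrite /= ?yx ?h1 // gmulfM mulgA.
  by exists w => //; rewrite -mulgA -gmulfM (eqP yx) multiplicative1 mulg1.
- have [/eqP yx|yx] := eqVneq (y * x)%g 1%g; last first.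
    by exists (inr (y * x)%g :: w); rewrite /= ?yx ?h1 // gmulfM mulgA.
  by exists w => //; rewrite -mulgA -gmulfM (eqP yx) multiplicative1 mulg1.
Qed.

Lemma reduced_word g : exists2 w, reduced w & word_val w = g.
Proof.
move: g; apply: free_product_ind; first by exists [::].
  by move=> g a [w rw <-]; exact: (reduced_mul (inl a)).
by move=> g b [w rw <-]; exact: (reduced_mul (inr b)).
Qed.

Section ChainAction.
Variables (R : realType) (V : normedModType R) (T : eqType).
Variable lact : letter -> T -> T.
Hypothesis lact1A : forall t, lact (inl 1%g) t = t.
Hypothesis lact1B : forall t, lact (inr 1%g) t = t.
Hypothesis lactMA : forall a a' t,
  lact (inl (a * a')%g) t = lact (inl a) (lact (inl a') t).
Hypothesis lactMB : forall b b' t,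
  lact (inr (b * b')%g) t = lact (inr b) (lact (inr b') t).
Variable w : seq (piece V T).
Hypothesis aw : alternating w.

Lemma color_inv l : color (letter_inv l) = color l.
Proof. by case: l. Qed.

Lemma lactK l : cancel (lact l) (lact (letter_inv l)).
Proof. by case: l => x t /=; rewrite -?lactMA -?lactMB mulVg. Qed.

Let act := chain_act color lact w.

Lemma actK l : cancel (act l) (act (letter_inv l)).
Proof. exact: (chain_actK color_inv lactK l aw). Qed.

Lemma actVK l : cancel (act (letter_inv l)) (act l).
Proof. by have := actK (letter_inv l); case: l => x; rewrite /= invgK. Qed.

Definition actA (a : A) : bijection (seq T) :=
  Bijection (actK (inl a)) (actVK (inl a)).
Definition actB (b : B) : bijection (seq T) :=
  Bijection (actK (inr b)) (actVK (inr b)).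

Lemma actA_mul : {morph actA : x y / (x * y)%g}.
Proof.
move=> x y; apply: bijection_eq.
by apply: (chain_act_comp color_inv lactK aw) => //; exact: lactMA.
Qed.

Lemma actB_mul : {morph actB : x y / (x * y)%g}.
Proof.
move=> x y; apply: bijection_eq.
by apply: (chain_act_comp color_inv lactK aw) => //; exact: lactMB.
Qed.

HB.instance Definition _ := isMultiplicative.Build A (bijection (seq T)) actA
  actA_mul.
HB.instance Definition _ := isMultiplicative.Build B (bijection (seq T)) actB
  actB_mul.

Lemma chain_action : exists rho : {multiplicative G -> bijection (seq T)},
  forall l x, rho (letter_val l) x = chain_act color lact w l x.
Proof.
have [rho [hA hB _]] := hG actA actB.
by exists rho => -[a|b] x /=; rewrite ?hA ?hB.
Qed.

End ChainAction.

End FreeProduct.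

(** * Box spaces *)

Section CosetMaps.
Variable R : realType.

Lemma control_unbounded (rho : R -> R) r : control_function rho ->
  exists M, forall t, M <= t -> r < rho t.
Proof.
case=> _ _ /cvgryPgt/(_ r)[M [_ hM]]; exists (M + 1) => t Mt.
by apply: hM; apply: lt_le_trans Mt; rewrite ltrDl.
Qed.

Variable Gam : groupType.
Implicit Types (N : groupClosed Gam) (C D : set Gam).

(** A left action of [Gam] on right cosets. As [quotient_dist] measures [x^-1 y], passing from [x]
    to [x g^-1] costs at most [l g] whatever [x] is; left translation would cost the length of a
    conjugate. *)
Definition rtrans (g : Gam) C : set Gam := [set (x * g^-1)%g | x in C].

Definition right_cosets N : set (set Gam) := range (rtrans^~ [set` N]).

Lemma rtrans1 C : rtrans 1%g C = C.
Proof. by rewrite /rtrans invg1; under eq_imagel do rewrite mulg1; rewrite image_id. Qed.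

Lemma rtransM g h C : rtrans (g * h)%g C = rtrans g (rtrans h C).
Proof.
rewrite /rtrans image_comp; apply: eq_imagel => x _ /=.
by rewrite invgM mulgA.
Qed.

Lemma right_cosets_rtrans N g C : right_cosets N C -> right_cosets N (rtrans g C).
Proof. by move=> [h _ <-]; exists (g * h)%g => //; rewrite rtransM. Qed.

Lemma right_cosets_base N : right_cosets N [set` N].
Proof. by exists 1%g; rewrite ?rtrans1. Qed.

Lemma rtrans_fix N g : rtrans g [set` N] = [set` N] -> g \in N.
Proof.
move=> h; have : [set` N] (g^-1)%g.
  by rewrite -h; exists 1%g; rewrite ?mul1g //= gpred1.
by rewrite /= gpredV.
Qed.

Lemma right_coset_left N C : normal_subgroup N -> right_cosets N C ->
  range (left_coset N) C.
Proof.
move=> nN [g _ <-]; exists (g^-1)%g => //; apply/seteqP; split=> x [y Ny <-] /=.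
  by exists (y ^ g)%g; [exact: nN|rewrite conjgE -!mulgA mulgV mulg1].
by exists (y ^ g^-1)%g; [exact: nN|rewrite conjgE invgK mulKg].
Qed.

Lemma right_coset_divg N C D x y : right_cosets N C -> right_cosets N D ->
  C x -> D y -> D = rtrans (x^-1 * y)^-1%g C.
Proof.
move=> [c _ <-] [d _ <-] [n Nn <-] [m Nm <-]; rewrite /rtrans invgK.
have e k : (k * c^-1 * ((n * c^-1)^-1 * (m * d^-1)) = k * (n^-1 * m) * d^-1)%g.
  by rewrite invgM invgK !mulgA mulgVK.
apply/seteqP; split=> z /=.
  move=> [k Nk <-]; exists (k * (m^-1 * n) * c^-1)%g.
    by exists (k * (m^-1 * n))%g => //=; rewrite !gpredM ?gpredVr.
  by rewrite e -!mulgA mulVKg mulKg.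
move=> [_ [k Nk <-] <-]; rewrite e.
by exists (k * (n^-1 * m))%g => //=; rewrite !gpredM ?gpredVr.
Qed.

Lemma right_coset_neq0 N C : right_cosets N C -> exists x, C x.
Proof. by move=> [c _ <-]; exists (1 * c^-1)%g, 1%g; rewrite //= gpred1. Qed.

(** The form in which a box space enters the construction: [beta] and [E] are independent of [n], so
    the control is uniform over the finite quotients. *)
Definition coset_hilbert_maps : Prop :=
  exists (H : completeNormedModType R) (N : nat -> groupClosed Gam)
    (Phi : nat -> set Gam -> H) (beta : Gam -> R) (E : R -> set Gam),
  is_hilbert H /\
  [/\ trivial_intersection N,
      forall n, finite_set (right_cosets (N n)),
      forall r, finite_set (E r),
      forall n g C, right_cosets (N n) C ->
        `|Phi n (rtrans g C) - Phi n C| <= beta g &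
      forall n r C D, right_cosets (N n) C -> right_cosets (N n) D ->
        `|Phi n C - Phi n D| <= r -> exists2 g, E r g & D = rtrans g C].

Lemma box_space_maps (X : metricType R) :
  is_box_space Gam X -> embeds_in_hilbert X -> coset_hilbert_maps.
Proof.
move=> [N [l [nN fN tN [l0 lM lV l1 lfin] [p [hf _ _]]]]].
move=> [H [hH [F [rho_m [rho_p [cm cp hF]]]]]].
pose f n := projT1 (cid (hf n)).
have fE n x y : mdist (f n x) (f n y) = quotient_dist l x y.
  by rewrite /f; case: cid => ? /= [_].
have inC n C : right_cosets (N n) C -> C \in range (left_coset (N n)).
  by move=> h; apply/mem_set/right_coset_left.
(* Sets that are not cosets get the default value 0. *)
pose Phi n C : H := if pselect (C \in range (left_coset (N n))) is left h
  then F (f n (exist _ C h)) else 0.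
pose quot C D := [set l g | g in [set (x^-1 * y)%g | x in C & y in D]].
have PhiE n C D : right_cosets (N n) C -> right_cosets (N n) D ->
    rho_m (inf (quot C D)) <= `|Phi n C - Phi n D| <= rho_p (inf (quot C D)).
  move=> /inC hC /inC hD; rewrite /Phi; case: pselect => // hC'.
  case: pselect => // hD'.
  by have := hF (f n (exist _ C hC')) (f n (exist _ D hD')); rewrite fE.
have Mr r : exists M, forall t, M <= t -> r < rho_m t by exact: control_unbounded.
pose M r := projT1 (cid (Mr r)).
have hM r t : M r <= t -> r < rho_m t by rewrite /M; case: cid => ? /= h; exact: h.
have lb (C D : set Gam) : has_lbound (quot C D) by exists 0 => _ [g _ <-].
have ne n C D : right_cosets (N n) C -> right_cosets (N n) D -> quot C D !=set0.
  move=> /right_coset_neq0[x Cx] /right_coset_neq0[y Dy].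
  by exists (l (x^-1 * y)%g), (x^-1 * y)%g => //; exists x => //; exists y.
(* From [M r] on, [rho_m] exceeds [r]. Images within [r] thus force the quotient distance below
   [M r], and a representing element lies in the finite ball of that radius. *)
exists H, N, Phi, (fun g => rho_p (l g)), (fun r => [set g | l g <= M r]).
split=> //; split=> //.
- move=> n; apply: sub_finite_set (fN n) => C.
  exact: right_coset_left.
- move=> n g C hC; have hgC := right_cosets_rtrans g hC.
  have /andP[_ h] := PhiE n _ _ hgC hC.
  apply: le_trans h _; case: cp => _ mono _; apply: mono.
    by apply: lb_le_inf; [exact: ne hgC hC|move=> _ [? _ <-]].
  have [x Cx] := right_coset_neq0 hC.
  apply: ge_inf => //; exists g => //; exists (x * g^-1)%g; first by exists x.
  by exists x; rewrite // invgM invgK mulgVK.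
- move=> n r C D hC hD h; have /andP[h' _] := PhiE n _ _ hC hD.
  have tM : inf (quot C D) < M r.
    by rewrite ltNge; apply/negP => /hM; rewrite ltNge (le_trans h' h).
  have [_ [_ [x Cx [y Dy <-]] <-] hl] := inf_lt (ne n _ _ hC hD) tM.
  exists (x^-1 * y)^-1%g; first by rewrite /= lV ltW.
  exact: right_coset_divg hC hD Cx Dy.
Qed.

End CosetMaps.

(** * Products of Hilbert spaces *)

Section ProductSpaces.
Variable R : realType.

Lemma hilbert_inner (H : completeNormedModType R) : is_hilbert H ->
  exists q : inner H, forall x, q x x = `|x| ^+ 2.
Proof.
case=> i hi.
have h1 x y z : i (x + y) z = i x z + i y z by rewrite linearDl.
have h2 a x y : i (a *: x) y = a * i x y by rewrite linearZl_LR.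
have h3 x y : i x y = i y x by rewrite hermC expr0 mul1r.
have h4 x : `|x| ^+ 2 <= i x x by rewrite hi.
have h5 : exists2 C, 0 <= C & forall x, i x x <= C * `|x| ^+ 2.
  by exists 1 => // x; rewrite hi mul1r.
by exists (Inner h1 h2 h3 h4 h5) => x /=; rewrite hi.
Qed.

Section Sum.
Variables (HA HB : normedModType R) (qA : inner HA) (qB : inner HB).

(** The spaces of both factors are combined with a line, which holds the coordinate that separates
    entries. *)
Definition sum_ip (x y : HA * HB * R) : R :=
  qA x.1.1 y.1.1 + qB x.1.2 y.1.2 + x.2 * y.2.

Lemma sum_ipDl x y z : sum_ip (x + y) z = sum_ip x z + sum_ip y z.
Proof. by rewrite /sum_ip /= !ipDl; ring. Qed.

Lemma sum_ipZl a x y : sum_ip (a *: x) y = a * sum_ip x y.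
Proof. by rewrite /sum_ip /= !ipZl -[a *: x.2]/(a * x.2); ring. Qed.

Lemma sum_ipC x y : sum_ip x y = sum_ip y x.
Proof. by rewrite /sum_ip ipC (ipC qB) mulrC. Qed.

Lemma sum_ip_lower x : `|x| ^+ 2 <= sum_ip x x.
Proof.
have max_le (a b c : R) :
    Num.max (Num.max a b) c ^+ 2 <= a ^+ 2 + b ^+ 2 + c ^+ 2.
  have := sqr_ge0 a; have := sqr_ge0 b; have := sqr_ge0 c.
  by rewrite /Num.max; do ?[case: ifP => _]; lra.
case: x => [[x y] z]; rewrite /sum_ip /= !prod_normE /=.
apply: le_trans (max_le _ _ _) _.
by rewrite (real_normK (num_real z)) -expr2 !lerD ?ip_lower.
Qed.

Lemma sum_ip_upper : exists2 C, 0 <= C & forall x, sum_ip x x <= C * `|x| ^+ 2.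
Proof.
have [CA CA0 hA] := ip_upper qA; have [CB CB0 hB] := ip_upper qB.
exists (CA + CB + 1) => [|[[x y] z]]; first by rewrite !addr_ge0.
have nx : `|x| <= `|(x, y, z)| by rewrite !prod_normE !le_max lexx.
have ny : `|y| <= `|(x, y, z)| by rewrite !prod_normE !le_max lexx orbT.
have nz : `|z| <= `|(x, y, z)| by rewrite !prod_normE !le_max lexx orbT.
rewrite /sum_ip /= !mulrDl mul1r !lerD //.
- by rewrite (le_trans (hA x)) // ler_wpM2l // ler_pXn2r ?nnegrE.
- by rewrite (le_trans (hB y)) // ler_wpM2l // ler_pXn2r ?nnegrE.
- by rewrite -expr2 -(real_normK (num_real z)) ler_pXn2r ?nnegrE.
Qed.

Definition sum_inner : inner (HA * HB * R)%type :=
  Inner sum_ipDl sum_ipZl sum_ipC sum_ip_lower sum_ip_upper.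

End Sum.

Definition cauchy_complete (V : normedModType R) : Prop :=
  forall F : set_system V, ProperFilter F -> cauchy F -> cvg F.

Lemma norm_fst (V W : normedModType R) (x : V * W) : `|x.1| <= `|x|.
Proof. by rewrite prod_normE le_max lexx. Qed.

Lemma norm_snd (V W : normedModType R) (x : V * W) : `|x.2| <= `|x|.
Proof. by rewrite prod_normE le_max lexx orbT. Qed.

Lemma cauchy_completeX (V W : normedModType R) : cauchy_complete V ->
  cauchy_complete W -> cauchy_complete (V * W)%type.
Proof.
move=> cV cW F PF /cauchyP cF.
have c1 : cvg (fst @ F).
  apply: cV; apply: cauchy_exP => e e0; have [[x y] h] := cF e e0.
  exists x; apply: (@filterS _ F _ _ _ _ h) => z; rewrite -!ball_normE /=; apply: le_lt_trans.
  have := norm_fst ((x, y) - z); exact.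
have c2 : cvg (snd @ F).
  apply: cW; apply: cauchy_exP => e e0; have [[x y] h] := cF e e0.
  exists y; apply: (@filterS _ F _ _ _ _ h) => z; rewrite -!ball_normE /=; apply: le_lt_trans.
  have := norm_snd ((x, y) - z); exact.
apply/cvg_ex; exists (lim (fst @ F), lim (snd @ F)).
have h := cvg_pair c1 c2.
have -> : F = (fun x : V * W => (x.1, x.2)) @ F.
  by apply/funext => S; rewrite /fmap; congr F; apply/seteqP; split=> -[].
exact: h.
Qed.

End ProductSpaces.

(** * Pieces made from finite quotients *)

Section CosetPieces.
Variables (R : realType) (Gam : groupType) (H : normedModType R).
Variables (N : nat -> groupClosed Gam) (Phi : nat -> set Gam -> H).
Variables (beta : Gam -> R) (E : R -> set Gam).
Hypothesis finN : forall n, finite_set (right_cosets (N n)).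
Hypothesis upper : forall n g C, right_cosets (N n) C ->
  `|Phi n (rtrans g C) - Phi n C| <= beta g.
Hypothesis lower : forall n r C D, right_cosets (N n) C ->
  right_cosets (N n) D -> `|Phi n C - Phi n D| <= r ->
  exists2 g, E r g & D = rtrans g C.

Variables (V : normedModType R) (q : inner V) (T : eqType).
Variables (L : Type) (col : L -> bool) (lact : L -> T -> T).
Variables (betaL : L -> R) (EL : R -> set L).
Variables (c : bool) (iota : Gam -> L) (j : set Gam -> T) (k : T -> set Gam).
Variable m : H -> R -> V.
Hypothesis col_iota : forall g, col (iota g) = c.
Hypothesis iota_col : forall l, col l = c -> exists g, l = iota g.
Hypothesis jK : cancel j k.
Hypothesis lact_iota : forall g C, lact (iota g) (j C) = j (rtrans g C).
Hypothesis m_dist : forall x y s t,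
  q (m x s - m y t) (m x s - m y t) = `|x - y| ^+ 2 + (s - t) ^+ 2.
Hypothesis betaL_iota : forall g, betaL (iota g) = beta g ^+ 2 + 1.
Hypothesis EL_iota : forall r g, E (Num.sqrt r) g -> EL r (iota g).

Definition off_base n C : R := (C != [set` N n])%:R.

(* The second coordinate keeps the image of every point at distance at least 1
   from the image of the entry. *)
Definition coset_piece n g : piece V T := Piece c (j [set` N n])
  (j (rtrans g [set` N n])) (j @` right_cosets (N n))
  (fun t => m (Phi n (k t)) (off_base n (k t))).

Lemma coset_piece_psqd n g C D : psqd q (coset_piece n g) (j C) (j D) =
  `|Phi n C - Phi n D| ^+ 2 + (off_base n C - off_base n D) ^+ 2.
Proof. by rewrite /psqd /= m_dist !jK. Qed.

(** One proof serves both factors: [iota] puts the group into the letters, [j] its cosets into the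
    common type of points, and [m] its vectors, with the extra real coordinate, into the common
    space. The square in [betaL_iota] and the root in [EL_iota] occur because [psqd] is a squared
    distance; the added 1 bounds the change of [off_base]. *)
Lemma coset_piece_good n g : piece_good q col lact betaL EL (coset_piece n g).
Proof.
split=> /=.
- split=> /=.
  + by exists [set` N n] => //; exact: right_cosets_base.
  + eexists; last exact: erefl.
    exact/right_cosets_rtrans/right_cosets_base.
  + move=> l _ /iota_col[h ->] [C hC <-]; rewrite lact_iota.
    by exists (rtrans h C) => //; exact: right_cosets_rtrans.
- exact: finite_image.
- move=> l _ /iota_col[h ->] [C hC <-].
  rewrite lact_iota coset_piece_psqd betaL_iota lerD //.
    rewrite ler_pXn2r ?nnegrE ?normr_ge0 ?upper //.
    exact: le_trans (normr_ge0 _) (upper h hC).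
  rewrite /off_base; case: eqP => _; case: eqP => _ /=; rewrite ?subr0 ?sub0r ?subrr;
    by rewrite ?sqrrN ?expr0n ?expr1n ?ler01.
- move=> r _ _ [C hC <-] [D hD <-]; rewrite coset_piece_psqd => h.
  have [|h' Eh' DC] := lower (r := Num.sqrt r) hC hD.
    rewrite -[leLHS]ger0_norm // -sqrtr_sqr ler_wsqrtr //.
    by apply: le_trans h; rewrite lerDl sqr_ge0.
  exists (iota h'); split; [exact: EL_iota|exact: col_iota|].
  by rewrite lact_iota DC.
- move=> _ [C hC <-] Cn; rewrite coset_piece_psqd /off_base eqxx subr0.
  have -> : C != [set` N n] by apply: contra Cn => /eqP ->.
  by rewrite expr1n lerDr sqr_ge0.
Qed.

End CosetPieces.

(** * The action of the free product on a chain *)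

(** The counterpart of [coset_hilbert_maps] for the free product. By invariance each [F i] is a map
    on the left cosets of [N i]; the last condition says that [e] carries the coset of [g] to that
    of [h], with [D] independent of [i]. *)
Definition coarse_family (R : realType) (G : groupType) (I : Type)
    (W : normedModType R) (N : I -> groupClosed G) (F : I -> G -> W) : Prop :=
  [/\ forall i, finite_index (N i),
      forall i g h, h \in N i -> F i (g * h)%g = F i g,
      forall s, exists b : R, forall i g, `|F i (s * g)%g - F i g| <= b &
      forall r, exists2 D : set G, finite_set D & forall i g h,
        `|F i g - F i h| <= r -> exists2 e, D e & (h^-1 * (e * g))%g \in N i].

Section ChainSubgroups.
Variables (R : realType) (A B G : groupType).
Variables (iA : {multiplicative A -> G}) (iB : {multiplicative B -> G}).
Hypothesis hG : is_free_product iA iB.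
Variables (V : normedModType R) (q : inner V) (T : eqType).
Variable lact : letter A B -> T -> T.
Hypothesis lact1A : forall t, lact (inl 1%g) t = t.
Hypothesis lact1B : forall t, lact (inr 1%g) t = t.
Hypothesis lactMA : forall a a' t,
  lact (inl (a * a')%g) t = lact (inl a) (lact (inl a') t).
Hypothesis lactMB : forall b b' t,
  lact (inr (b * b')%g) t = lact (inr b) (lact (inr b') t).
Variables (beta : letter A B -> R) (E : R -> set (letter A B)).
Hypothesis beta_ge0 : forall l, 0 <= beta l.
Hypothesis finE : forall r, finite_set (E r).

Notation good := (piece_good q (@color A B) lact beta E).
Notation val := (letter_val iA iB).
Notation word_val := (word_val iA iB).

Hypothesis pieces : forall l, nontrivial l -> exists p : piece V T,
  [/\ good p, pcol p = color l, pexit p = lact l (pentry p) &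
      pexit p != pentry p].

Record chain_rep := ChainRep {
  rep_word :> seq (piece V T);
  rep_alternating : alternating rep_word;
  rep_good : List.Forall good rep_word;
  rep_act : {multiplicative G -> bijection (seq T)};
  rep_actE : forall l x, rep_act (val l) x = chain_act (@color A B) lact rep_word l x
}.

Section OneRep.
Variable rho : chain_rep.

Definition rep_orbit (g : G) : seq T := rep_act rho g (base rho).

Lemma rep_actM g h x : rep_act rho (g * h)%g x = rep_act rho g (rep_act rho h x).
Proof. by rewrite gmulfM. Qed.

Lemma rep_act1 x : rep_act rho 1%g x = x.
Proof. by rewrite multiplicative1. Qed.

Lemma rep_actV g : cancel (rep_act rho g) (rep_act rho g^-1%g).
Proof. by move=> x; rewrite -rep_actM mulVg rep_act1. Qed.

Lemma rep_chain g x : chain rho x -> chain rho (rep_act rho g x).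
Proof.
have step l y : chain rho y -> chain rho (rep_act rho (val l) y).
  move=> hy; rewrite rep_actE; apply: chain_act_chain => //.
    exact: rep_alternating.
  exact: good_closed (rep_good rho).
move: g x; apply: (free_product_ind hG) => [x|g a IH x|g b IH x] hx.
- by rewrite rep_act1.
- by rewrite rep_actM; apply: IH; exact: (step (inl a)).
- by rewrite rep_actM; apply: IH; exact: (step (inr b)).
Qed.

Lemma rep_orbit_chain g : chain rho (rep_orbit g).
Proof. exact/rep_chain/base_chain/(good_closed (rep_good rho)). Qed.

Definition stabilizer : groupClosed G :=
  @subgroup_of _ (fun g => rep_orbit g = base rho) (rep_act1 _)
    (fun g h gb hb => etrans (rep_actM g h _) (etrans (congr1 _ hb) gb))
    (fun g gb => etrans (congr1 (rep_act rho g^-1%g) (esym gb)) (rep_actV g _)).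

Lemma stabilizerP g : reflect (rep_orbit g = base rho) (g \in stabilizer).
Proof. exact: subgroup_ofP. Qed.

Lemma rep_orbit_eq g h : (rep_orbit g = rep_orbit h) <-> (h^-1 * g)%g \in stabilizer.
Proof.
split=> [gh|/stabilizerP]; first apply/stabilizerP;
  rewrite /rep_orbit rep_actM.
  by rewrite -!/(rep_orbit _) gh rep_actV.
by move=> /(congr1 (rep_act rho h)); rewrite -rep_actM mulgV rep_act1.
Qed.

(** The orbit of the base point lies in the chain, which is finite, and the left cosets of the
    stabilizer are the fibres of the orbit map. *)
Lemma stabilizer_finite_index : finite_index stabilizer.
Proof.
have fch : finite_set [set x | chain rho x].
  apply: chain_finite => p pw.
  exact: pgood_finite ((List.Forall_forall _ _).1 (rep_good rho) p pw).
apply: sub_finite_set (finite_image (fun x => [set g | rep_orbit g = x]) fch).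
move=> _ [g _ <-]; exists (rep_orbit g); first exact: rep_orbit_chain.
apply/seteqP; split=> h /=.
  by move=> /rep_orbit_eq hg; exists (g^-1 * h)%g; rewrite ?mulVKg.
by move=> [k hk <-]; apply/rep_orbit_eq; rewrite mulKg.
Qed.

(** [w1] consists of the pieces already crossed, which stand at their exits; each further letter
    crosses one more piece. *)
Lemma rep_exits w1 (w2 : seq (piece V T)) u : rep_word rho = w1 ++ w2 ->
    List.Forall2 (fun l p => pcol p = color l /\ pexit p = lact l (pentry p)) u w2 ->
  rep_act rho (word_val u) (map (@pexit _ _ _) w1 ++ base w2) =
  map (@pexit _ _ _) (w1 ++ w2).
Proof.
move=> + h; elim: h w1 => [|l p {}u {}w2 [pl pe] _ IH] w1 rw /=.
  by rewrite rep_act1 !cats0.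
rewrite rep_actM rep_actE rw chain_act_exits -?rw //; last exact: rep_alternating.
have := IH (rcons w1 p); rewrite -cats1 -!catA /= map_cat -catA /=.
by rewrite rw; exact.
Qed.

End OneRep.

(** The bounds for the letters add up along a product and do not depend on the chain. *)
Lemma rep_upper (s : G) : exists b : R, forall (rho : chain_rep) x, chain rho x ->
  `|chain_map q rho (rep_act rho s x) - chain_map q rho x| <= b.
Proof.
have step l (rho : chain_rep) x : chain rho x ->
    `|chain_map q rho (rep_act rho (val l) x) - chain_map q rho x| <=
    Num.sqrt (beta l).
  move=> cx; rewrite -[leLHS]ger0_norm // -sqrtr_sqr ler_wsqrtr // rep_actE.
  exact: chain_upper (rep_good rho) cx.
have mul g l : (exists b : R, forall (rho : chain_rep) x, chain rho x ->
    `|chain_map q rho (rep_act rho g x) - chain_map q rho x| <= b) ->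
  exists b : R, forall (rho : chain_rep) x, chain rho x ->
    `|chain_map q rho (rep_act rho (g * val l)%g x) - chain_map q rho x| <= b.
  move=> [b hb]; exists (b + Num.sqrt (beta l)) => rho x cx; rewrite rep_actM.
  rewrite -(subrKA (chain_map q rho (rep_act rho (val l) x))).
  apply: le_trans (ler_normD _ _) _; apply: lerD; last exact: step.
  by apply: hb; exact: rep_chain.
move: s; apply: (free_product_ind hG) => [|g a|g b].
- by exists 0 => rho x _; rewrite rep_act1 subrr normr0.
- exact: (mul g (inl a)).
- exact: (mul g (inr b)).
Qed.

Fixpoint word_ball (D : set (letter A B)) (n : nat) : set G :=
  if n is n'.+1 then word_ball D n' `|`
    [set (val u.1 * u.2)%g | u in D `*` word_ball D n']
  else [set 1%g].

Lemma word_ball_finite D n : finite_set D -> finite_set (word_ball D n).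
Proof.
move=> fD; elim: n => [|n IH] /=; first exact: finite_set1.
rewrite finite_setU; split=> //.
by apply: finite_image; apply: finite_setX.
Qed.

Lemma word_ball1 D n : word_ball D n 1%g.
Proof. by elim: n => [|n IH] //=; left. Qed.

Lemma reach_word_ball (rho : chain_rep) D n x y :
  reach (@color A B) lact D rho n x y ->
  exists2 g, word_ball D n g & y = rep_act rho g x.
Proof.
elim=> [{}n {}x|{}n {}x {}y l _ [g Dg ->] Dl].
  by exists 1%g; rewrite ?rep_act1 //; exact: word_ball1.
exists (val l * g)%g; last by rewrite rep_actM rep_actE.
by right; exists (l, g).
Qed.

(** The chain has one piece for each letter of a reduced word of [g]. The condition on [g] stands
    inside the existential so that a chain can be chosen for every element of [G]. *)
Lemma rep_exists (g : G) : exists rho : chain_rep,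
  g <> 1%g -> rep_orbit rho g <> base rho.
Proof.
have [u ru <-] := reduced_word hG g.
have [w [aw gw uw]] : exists w : seq (piece V T), [/\ alternating w,
    List.Forall good w & List.Forall2
      (fun l p => pcol p = color l /\ pexit p = lact l (pentry p)) u w].
  elim: u ru => [|l u IH] /=.
    by move=> _; exists [::]; split=> //; constructor.
  move=> /and3P[nl hl /IH[w [aw gw uw]]].
  have [p [gp pl pe pn]] := pieces nl.
  exists (p :: w); split; [|by constructor|by constructor].
  rewrite /= pn aw andbT /= pl.
  case: uw hl {aw gw IH} => [//|l' p' u' w' [pl' _] _] /=.
  by rewrite pl'; apply: contra => /eqP[->].
have [rho rhoE] := chain_action hG lact1A lact1B lactMA lactMB aw.
exists (ChainRep aw gw rhoE) => g1.
have -> : rep_orbit (ChainRep aw gw rhoE) (word_val u) = map (@pexit _ _ _) w.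
  exact: (@rep_exits (ChainRep aw gw rhoE) [::] w u erefl uw).
move=> h; have {}h : map (@pexit _ _ _) w = base w by [].
(* A nonempty word moves the first coordinate from the entry to a different exit; the empty word
   contradicts [g1]. *)
case: uw g1 h aw {gw rho rhoE} => [|l p u' w' _ _] /= g1 h aw; first by [].
by case/and3P: aw => /eqP pn _ _; case: h.
Qed.

Lemma chain_subgroups :
  exists (N : G -> groupClosed G) (F : G -> G -> l2 q),
    coarse_family N F /\ forall g, g <> 1%g -> g \notin N g.
Proof.
pose rep g0 := projT1 (cid (rep_exists g0)).
exists (fun g0 => stabilizer (rep g0)).
exists (fun g0 g => chain_map q (rep g0) (rep_orbit (rep g0) g)); split; last first.
  move=> g0 g01; rewrite /rep; case: cid => rho /= /(_ g01) h.
  by apply/negP => /stabilizerP.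
split.
- by move=> g0; exact: stabilizer_finite_index.
- by move=> g0 g h /stabilizerP hb; rewrite /rep_orbit rep_actM -/(rep_orbit _ h) hb.
- move=> s; have [b hb] := rep_upper s; exists b => g0 g.
  by rewrite /rep_orbit rep_actM; apply: hb; exact: rep_orbit_chain.
(* Images within [r] have squared distance at most [r ^+ 2], so [chain_lower] provides at most
   [2 + r ^+ 2] letters from a finite set. *)
- move=> r; pose n := Num.bound (2 + r ^+ 2).
  exists (word_ball (E (r ^+ 2)) n); first exact: word_ball_finite.
  move=> g0 g h hr.
  have sr : sqd q (rep g0) (rep_orbit (rep g0) g) (rep_orbit (rep g0) h) <= r ^+ 2.
    by rewrite ler_pXn2r ?nnegrE ?(le_trans _ hr).
  have [m hm rm] := chain_lower (rep_alternating (rep g0)) (rep_good (rep g0))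
    (rep_orbit_chain _ g) (rep_orbit_chain _ h) sr.
  have mn : (m <= n)%N.
    rewrite -(ler_nat R); apply: le_trans hm _.
    have := archi_boundP (x := 2 + r ^+ 2); rewrite -/n => /(_ _)/ltW h'.
    apply: le_trans (h' _); first by rewrite lerD2l.
    by rewrite addr_ge0 // sqr_ge0.
  have [e De he] := reach_word_ball (reach_leq mn rm).
  by exists e => //; apply/rep_orbit_eq; rewrite {1}/rep_orbit rep_actM -he.
Qed.

End ChainSubgroups.

(** * From the box spaces of the factors to subgroups of the free product *)

Section FreeProductMaps.
Variables (R : realType) (A B G : groupType).
Variables (iA : {multiplicative A -> G}) (iB : {multiplicative B -> G}).
Hypothesis hG : is_free_product iA iB.

(** The common type of points: a coset of one factor is paired with the empty set in the other
    component. *)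
Definition letter_rtrans (l : letter A B) (t : set A * set B) :=
  match l with
  | inl a => (rtrans a t.1, t.2)
  | inr b => (t.1, rtrans b t.2)
  end.

Lemma free_product_maps : coset_hilbert_maps R A -> coset_hilbert_maps R B ->
  exists (W : normedModType R) (q : inner W) (u : W),
  [/\ forall x, q x x = `|x| ^+ 2, cauchy_complete W, `|u| = 1 &
    exists (N : G -> groupClosed G) (F : G -> G -> W),
      coarse_family N F /\ forall g, g <> 1%g -> g \notin N g].
Proof.
move=> [HA [NA [PhiA [betaA [EA [hA [tA fA eA uA lA]]]]]]].
move=> [HB [NB [PhiB [betaB [EB [hB [tB fB eB uB lB]]]]]]].
have [qA qAE] := hilbert_inner hA; have [qB qBE] := hilbert_inner hB.
pose q := sum_inner qA qB.
have Vc : cauchy_complete (HA * HB * R)%type.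
  apply: cauchy_completeX; last by move=> F; exact: R_complete.
  by apply: cauchy_completeX => F PF; exact: cauchy_cvg.
(* The unit vector, taken on the extra real line, is the direction that later records the index of a
   component. *)
exists (l2 q), (l2inner q), (l2cons (q := q) (0, 0, 1) 0); split.
- by move=> x; rewrite l2_normE.
- by move=> F; exact: l2_complete.
- apply/eqP; rewrite -(@eqrXn2 _ 2) // l2cons_norm normr0 expr1n expr0n addr0.
  by rewrite /= /sum_ip /= !ip0 mul1r !add0r.
pose beta (l : letter A B) : R :=
  match l with inl a => betaA a ^+ 2 + 1 | inr b => betaB b ^+ 2 + 1 end.
pose E (r : R) : set (letter A B) :=
  (@inl A B @` EA (Num.sqrt r)) `|` (@inr A B @` EB (Num.sqrt r)).
pose pA n g := coset_piece NA PhiA true (fun C => (C, set0 : set B)) fst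
  (fun x s => (x, 0, s) : (HA * HB * R)%type) n g.
pose pB n g := coset_piece NB PhiB false (fun C => (set0 : set A, C)) snd
  (fun x s => (0, x, s) : (HA * HB * R)%type) n g.
have goodA n g : piece_good q (@color A B) letter_rtrans beta E (pA n g).
  apply: (coset_piece_good fA uA lA (iota := inl)) => //.
  - by move=> [a|b] // _; exists a.
  - move=> x y s t; rewrite /= /sum_ip /= qAE subr0 ip0 addr0 -expr2.
    by [].
  - by move=> r h Eh; left; exists h.
have goodB n g : piece_good q (@color A B) letter_rtrans beta E (pB n g).
  apply: (coset_piece_good fB uB lB (iota := inr)) => //.
  - by move=> [a|b] // _; exists b.
  - move=> x y s t; rewrite /= /sum_ip /= qBE subr0 ip0 add0r -expr2.
    by [].
  - by move=> r h Eh; right; exists h.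
(* A nontrivial letter survives in one of the quotients of its factor; this quotient supplies its
   piece. *)
have escape (Gam : groupType) (N : nat -> groupClosed Gam) g :
    trivial_intersection N -> g != 1%g -> exists n, g \notin N n.
  move=> tN g1; apply: contrapT => h; move/eqP: g1; apply; apply: tN => n.
  by apply/negPn/negP => gn; apply: h; exists n.
apply: (@chain_subgroups _ _ _ _ _ _ hG _ q _ letter_rtrans _ _ _ _ beta E).
- by move=> [C D]; rewrite /= rtrans1.
- by move=> [C D]; rewrite /= rtrans1.
- by move=> a a' [C D]; rewrite /= rtransM.
- by move=> b b' [C D]; rewrite /= rtransM.
- by move=> [a|b] /=; rewrite addr_ge0 ?sqr_ge0.
- by move=> r; rewrite finite_setU; split; exact: finite_image.
move=> [a|b] /= l1.
  have [n an] := escape _ NA a tA l1; exists (pA n a); split=> //.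
  by apply: contra an => /eqP[/rtrans_fix].
have [n bn] := escape _ NB b tB l1; exists (pB n b); split=> //.
by apply: contra bn => /eqP[/rtrans_fix].
Qed.

End FreeProductMaps.

(** * Coarse disjoint unions *)

Section CoarseUnion.
Variables (R : realType) (T : nat -> Type) (d : forall n, T n -> T n -> R).
Variable b : forall n, T n.
Hypothesis dxx : forall n (x : T n), d x x = 0.
Hypothesis d_eq0 : forall n (x y : T n), d x y = 0 -> x = y.
Hypothesis dC : forall n (x y : T n), d x y = d y x.
Hypothesis d_triangle : forall n (x y z : T n), d x z <= d x y + d y z.
Hypothesis d_bounded : forall n, exists M, forall x : T n, d x (b n) <= M.

Definition union : Type := {n & T n}.

HB.instance Definition _ := gen_eqMixin union.
HB.instance Definition _ := gen_choiceMixin union.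

Definition gap (n m : nat) : R := `|2 ^+ n - 2 ^+ m|.

Definition to_base (u : union) : R := d (tagged u) (b (tag u)).

(** Different components are joined through their base points, which are put at distance [gap]. *)
Definition union_dist (u v : union) : R :=
  if tag u == tag v then d (tagged u) (tagged_as u v)
  else gap (tag u) (tag v) + to_base u + to_base v.

Lemma union_dist_same n (x y : T n) :
  union_dist (Tagged T x) (Tagged T y) = d x y.
Proof. by rewrite /union_dist eqxx tagged_asE. Qed.

Lemma union_dist_diff u v : tag u != tag v ->
  union_dist u v = gap (tag u) (tag v) + to_base u + to_base v.
Proof. by rewrite /union_dist => /negbTE ->. Qed.

Lemma d_ge0 n (x y : T n) : 0 <= d x y.
Proof. by have := d_triangle x y x; rewrite dxx (dC y x) -mulr2n pmulrn_lge0. Qed.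

Lemma gap_gt0 n m : n != m -> 0 < gap n m.
Proof.
move=> nm; rewrite normr_gt0 subr_eq0; apply: contra nm.
by rewrite -!natrX eqr_nat eqn_exp2l.
Qed.

Lemma gapC n m : gap n m = gap m n.
Proof. exact: distrC. Qed.

Lemma gap_triangle n m k : gap n k <= gap n m + gap m k.
Proof. exact: ler_distD. Qed.

Lemma gap_ge0 n m : 0 <= gap n m.
Proof. exact: normr_ge0. Qed.

Lemma to_base_ge0 u : 0 <= to_base u.
Proof. exact: d_ge0. Qed.

Lemma union_distxx u : union_dist u u = 0.
Proof. by case: u => n x; rewrite union_dist_same. Qed.

Lemma union_distC u v : union_dist u v = union_dist v u.
Proof.
have [e|ne] := eqVneq (tag u) (tag v).
  by case: u v e => n x [m y] /= e; case: _ / e in y *; rewrite !union_dist_same.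
by rewrite !union_dist_diff // 1?eq_sym // gapC addrAC.
Qed.

Lemma union_dist_eq0 u v : union_dist u v = 0 -> u = v.
Proof.
have [e|ne] := eqVneq (tag u) (tag v).
  case: u v e => n x [m y] /= e; case: _ / e in y *.
  by rewrite union_dist_same => /d_eq0 ->.
rewrite union_dist_diff // => h; exfalso; have := gap_gt0 ne.
by have := to_base_ge0 u; have := to_base_ge0 v; lra.
Qed.

Lemma gap_le_union_dist u v : gap (tag u) (tag v) <= union_dist u v.
Proof.
have [e|ne] := eqVneq (tag u) (tag v).
  case: u v e => n x [m y] /= e; case: _ / e in y *.
  by rewrite union_dist_same /gap subrr normr0 d_ge0.
by rewrite union_dist_diff // -addrA lerDl addr_ge0 ?to_base_ge0.
Qed.

Lemma to_base_le_union_dist u v : to_base u <= union_dist u v + to_base v.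
Proof.
have [e|ne] := eqVneq (tag u) (tag v).
  case: u v e => n x [m y] /= e; case: _ / e in y *.
  by rewrite union_dist_same d_triangle.
rewrite union_dist_diff //; have := gap_ge0 (tag u) (tag v).
by have := to_base_ge0 v; lra.
Qed.

Lemma union_dist_triangle v u w :
  union_dist u w <= union_dist u v + union_dist v w.
Proof.
have uv := to_base_le_union_dist u v; have wv := to_base_le_union_dist w v.
have guv := gap_le_union_dist u v; have gvw := gap_le_union_dist v w.
have g := gap_triangle (tag u) (tag v) (tag w).
have u0 := to_base_ge0 u; have v0 := to_base_ge0 v; have w0 := to_base_ge0 w.
rewrite (union_distC w) in wv.
have [e|ne] := eqVneq (tag u) (tag w).
  have [e'|ne'] := eqVneq (tag u) (tag v).
    case: u v w e e' {uv wv guv gvw g u0 v0 w0} => n x [m y] [k z] /= e e'.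
    by case: _ / e in z *; case: _ / e' in y *; rewrite !union_dist_same.
  rewrite (union_dist_diff ne') (@union_dist_diff v w) -?e 1?eq_sym //.
  (* The middle point is in another component, so both legs pass through the base point of the
     common component of [u] and [w]. *)
  have : union_dist u w <= to_base u + to_base w.
    case: u w e {uv wv guv gvw g u0 v0 w0 ne'} => n x [k z] /= e.
    case: _ / e in z *; rewrite union_dist_same /to_base /= (dC z).
    exact: d_triangle.
  have := gap_ge0 (tag u) (tag v); have := gap_ge0 (tag v) (tag u); lra.
rewrite (union_dist_diff ne).
have [e'|ne'] := eqVneq (tag u) (tag v).
  move: ne uv; rewrite e' => ne uv.
  by rewrite (union_dist_diff ne); lra.
rewrite (union_dist_diff ne').
have [e''|ne''] := eqVneq (tag v) (tag w).
  by rewrite -e''; move: wv; lra.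
by rewrite (union_dist_diff ne''); lra.
Qed.

Definition union_metric : metricType R := HB.pack_for (metricType R) union
  (isMetric.Build R union union_distxx union_dist_eq0 union_distC
     union_dist_triangle).

Lemma union_mdistE (u v : union_metric) : mdist u v = union_dist u v.
Proof. by []. Qed.

Lemma union_is_coarse : coarse_disjoint_union d union_metric.
Proof.
exists (fun u : union_metric => tag u); split.
- move=> n; exists (fun x : T n => Tagged T x : union_metric); split=> [|x y].
    apply/seteqP; split=> [_ [x _ <-] //|[m x] /= e].
    by case: _ / e; exists x.
  by rewrite union_mdistE union_dist_same.
- exists id; first by split=> //; exact: cvg_id.
  by move=> u v; exact: gap_le_union_dist.
- move=> r n m _ _; have [M hM] := d_bounded n; exists (M + M).
  move=> [k x] [l y] [/= e _] [/= e' _]; subst k l.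
  rewrite union_mdistE union_dist_same.
  by apply: le_trans (d_triangle x (b n) y) _; rewrite lerD // dC.
Qed.

End CoarseUnion.

(** * Coarse embeddings of unions *)

Section CoarseEmbedding.
Variable R : realType.

Lemma coarse_embedding (X Y : Type) (dX : X -> X -> R) (dY : Y -> Y -> R)
    (F : X -> Y) (C : R) :
    (forall x y, 0 <= dX x y) -> (forall x y, 0 <= dY x y) -> 0 <= C ->
    (forall x y, dY (F x) (F y) <= C * dX x y) ->
    (forall r, exists M, forall x y, dY (F x) (F y) <= r -> dX x y <= M) ->
  coarsely_embeds dX dY.
Proof.
move=> dX0 dY0 C0 lip prop.
(* The infimum of [far t] is the lower control. Adjoining [t] keeps the set nonempty when no two
   points are that far apart, and lets the infimum tend to infinity in that case too. *)
pose far t := t |` [set r | exists x y, t <= dX x y /\ r = dY (F x) (F y)].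
have far_lb t : 0 <= t -> lbound (far t) 0.
  by move=> t0 _ [->|[x [y [_ ->]]]] //; exact: dY0.
have far_inf t r : 0 <= t -> far t r -> inf (far t) <= r.
  by move=> t0; apply: ge_inf; exists 0; exact: far_lb.
have far_ne t : far t !=set0 by exists t; left.
(* [C + 1] makes the upper control proper even when [C = 0]. *)
exists F, (fun t => inf (far t)), (fun t => (C + 1) * t); split.
- split=> [t t0|s t s0 st|].
  + by apply: lb_le_inf => //; exact: far_lb.
  + apply: lb_le_inf => // _ [->|[x [y [txy ->]]]].
      by apply: le_trans st; apply: far_inf => //; left.
    by apply: far_inf => //; right; exists x, y; rewrite (le_trans st).
  + apply/cvgryPge => A; have [M hM] := prop A.
    exists (Num.max A M); split; first exact: num_real.
    move=> t; rewrite gt_max => /andP[At Mt].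
    apply: lb_le_inf => // _ [->|[x [y [txy ->]]]]; first exact: ltW.
    rewrite leNgt; apply/negP => /ltW/hM; apply/negP; rewrite -ltNge.
    exact: lt_le_trans txy.
- have C1 : 0 < C + 1 by rewrite ltr_pwDr.
  split=> [t t0|s t s0 st|].
  + by rewrite mulr_ge0 // ltW.
  + by rewrite ler_wpM2l // ltW.
  + apply/cvgryPge => A; exists (Num.max A 0); split; first exact: num_real.
    move=> t; rewrite gt_max => /andP[At t0]; apply: le_trans (ltW At) _.
    by rewrite mulrDl mul1r lerDr mulr_ge0 // ltW.
- move=> x y; apply/andP; split.
    by apply: far_inf => //; right; exists x, y.
  by apply: le_trans (lip x y) _; rewrite ler_wpM2r // lerDl.
Qed.

Section UnionEmbedding.
Variables (W : normedModType R) (q : inner W).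
Hypothesis W_complete : cauchy_complete W.

Let l2cplt : cauchy_complete (l2 q) := l2_complete W_complete.

Definition l2_hilbert : completeNormedModType R :=
  HB.pack_for (completeNormedModType R) (l2 q)
    (Uniform_isComplete.Build (l2 q) l2cplt).

Lemma l2_hilbertP : is_hilbert l2_hilbert.
Proof.
have li : bilinear_for *%R *%R (@l2ip R W q : l2 q -> l2 q -> R).
  split=> [f|f] a g h; first by rewrite l2ipDl l2ipZl.
  by rewrite l2ipC l2ipDl l2ipZl !(l2ipC _ f).
have sy (f g : l2 q) : l2ip f g = (-1) ^+ false * idfun (l2ip g f).
  by rewrite expr0 mul1r; exact: l2ipC.
have po (f : l2 q) : f != 0 -> 0 < l2ip f f.
  move=> f0; rewrite lt_def l2ip_ge0 andbT; apply: contra f0 => /eqP h.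
  by rewrite (l2ip_eq0 h).
pose D : {dot l2_hilbert for idfun} := HB.pack_for {dot l2_hilbert for idfun}
  (@l2ip R W q : l2_hilbert -> l2_hilbert -> R)
  (@bilinear_isBilinear.Build R l2_hilbert l2_hilbert R *%R *%R _ li)
  (@isHermitianSesquilinear.Build R l2_hilbert false idfun _ sy)
  (@isDotProduct.Build R l2_hilbert _ po).
by exists D => f; exact: l2_normE.
Qed.

Fixpoint l2single (n : nat) (w : W) : l2 q :=
  if n is n'.+1 then l2cons 0 (l2single n' w) else l2cons w 0.

Lemma l2singleB n v w : l2single n v - l2single n w = l2single n (v - w).
Proof. by elim: n => [|n IH] /=; rewrite l2consB ?IH !subr0. Qed.

Lemma l2single_same n w : l2single n w n = w.
Proof. by elim: n. Qed.

Lemma l2single_diff n m w : n != m -> l2single n w m = 0.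
Proof. by elim: n m => [|n IH] [|m] //= nm; exact: IH. Qed.

Hypothesis qE : forall w, q w w = `|w| ^+ 2.

Lemma l2single_norm n w : `|l2single n w| = `|w|.
Proof.
apply/eqP; rewrite -(@eqrXn2 _ 2) //.
by elim: n => [|n IH] /=; rewrite l2cons_norm ?(eqP IH) ?normr0 ?ip0 ?add0r // qE
  expr0n addr0.
Qed.

Variable u : W.
Hypothesis u1 : `|u| = 1.
Variables (T : nat -> Type) (d : forall n, T n -> T n -> R).
Variable b : forall n, T n.
Hypothesis dxx : forall n (x : T n), d x x = 0.
Hypothesis d_eq0 : forall n (x y : T n), d x y = 0 -> x = y.
Hypothesis dC : forall n (x y : T n), d x y = d y x.
Hypothesis d_triangle : forall n (x y z : T n), d x z <= d x y + d y z.
Variables (F : forall n, T n -> W) (C : R).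
Hypothesis C0 : 0 <= C.
Hypothesis F_upper : forall n (x y : T n), `|F x - F y| <= C * d x y.
Hypothesis F_lower : forall r, exists M, forall n (x y : T n),
  `|F x - F y| <= r -> d x y <= M.

Notation X := (union_metric b dxx d_eq0 dC d_triangle).

(** Coordinate 0 places component [n] at [2 ^+ n] along [u], which reproduces the gaps. Coordinate
    [n + 1] is reserved for component [n], translated so that its base point goes to 0. *)
Definition union_map (x : union T) : l2 q :=
  l2cons (2 ^+ tag x *: u) (l2single (tag x) (F (tagged x) - F (b (tag x)))).

Lemma union_map_same n (x y : T n) :
  `|union_map (Tagged T x) - union_map (Tagged T y)| = `|F x - F y|.
Proof.
apply/eqP; rewrite -(@eqrXn2 _ 2) // l2consB l2singleB /=.
by rewrite subrr l2cons_norm ip0 add0r l2single_norm opprB subrKA.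
Qed.

Lemma union_map_diff x y :
  `|union_map x - union_map y| ^+ 2 = gap R (tag x) (tag y) ^+ 2 +
  `|l2single (tag x) (F (tagged x) - F (b (tag x))) -
    l2single (tag y) (F (tagged y) - F (b (tag y)))| ^+ 2.
Proof.
by rewrite l2consB l2cons_norm -scalerBl qE normrZ u1 mulr1.
Qed.

Lemma union_embeds : embeds_in_hilbert X.
Proof.
exists l2_hilbert; split; first exact: l2_hilbertP.
apply: (coarse_embedding (F := union_map) (C := C + 1)).
- by move=> x y; exact: mdist_ge0.
- by move=> x y; exact: normr_ge0.
- by rewrite addr_ge0.
- move=> x y; rewrite union_mdistE; have [e|ne] := eqVneq (tag x) (tag y).
    case: x y e => n x [m y] /= e; case: _ / e in y *.
    rewrite union_dist_same union_map_same; apply: le_trans (F_upper x y) _.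
    by rewrite ler_wpM2r ?(d_ge0 dxx) // lerDl.
  rewrite (union_dist_diff _ _ ne) !mulrDr.
  (* Across components, the path through both base points is bounded leg by leg. *)
  have hb z : `|union_map z - union_map (Tagged T (b (tag z)))| <=
      (C + 1) * to_base d b z.
    case: z => n z; rewrite union_map_same; apply: le_trans (F_upper _ _) _.
    by rewrite ler_wpM2r ?(d_ge0 dxx) // lerDl.
  have hg : `|union_map (Tagged T (b (tag x))) - union_map (Tagged T (b (tag y)))|
      <= (C + 1) * gap R (tag x) (tag y).
    have g0 := gap_ge0 R (tag x) (tag y).
    apply: (@le_trans _ _ (gap R (tag x) (tag y))).
      rewrite -(@ler_pXn2r _ 2) ?nnegrE // union_map_diff /= !subrr.
      have s0 n : l2single n 0 = 0.
        by apply/normr0_eq0; rewrite l2single_norm normr0.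
      by rewrite !s0 subrr normr0 expr0n addr0.
    by rewrite mulrDl mul1r lerDr mulr_ge0.
  have t1 := ler_distD (union_map (Tagged T (b (tag x)))) (union_map x) (union_map y).
  have t2 := ler_distD (union_map (Tagged T (b (tag y))))
    (union_map (Tagged T (b (tag x)))) (union_map y).
  have hy := hb y; rewrite distrC in hy.
  apply: le_trans t1 _; rewrite -addrA addrCA lerD ?hb //.
  by apply: le_trans t2 _; rewrite lerD.
- move=> r; have [M hM] := F_lower r; exists (Num.max M 0 + r + Num.max M 0 + Num.max M 0).
  have M0 : 0 <= Num.max M 0 by rewrite le_max lexx orbT.
  move=> x y h; have r0 : 0 <= r := le_trans (normr_ge0 _) h.
  rewrite union_mdistE; have [e|ne] := eqVneq (tag x) (tag y).
    case: x y e h => n x [m y] /= e h; case: _ / e in y h *.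
    rewrite union_dist_same; move: h; rewrite union_map_same => /hM h.
    by rewrite -!addrA ler_wpDr ?addr_ge0 // le_max h.
  rewrite (union_dist_diff _ _ ne).
  have h2 : `|union_map x - union_map y| ^+ 2 <= r ^+ 2.
    by rewrite ler_pXn2r ?nnegrE ?normr_ge0.
  rewrite union_map_diff in h2; set v := _ - _ in h2.
  have hgap : gap R (tag x) (tag y) <= r.
    rewrite -(@ler_pXn2r _ 2) ?nnegrE ?gap_ge0 //; apply: le_trans h2.
    by rewrite lerDl sqr_ge0.
  have hv : `|v| <= r.
    rewrite -(@ler_pXn2r _ 2) ?nnegrE //; apply: le_trans h2.
    by rewrite lerDr sqr_ge0.
  have hx : to_base d b x <= Num.max M 0.
    rewrite le_max; apply/orP; left; apply: hM; apply: le_trans hv.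
    (* The tags being different, coordinate [tag x] of [v] comes from [x] alone, so [F_lower] bounds
       the distance from [x] to its base point. *)
    have := l2_norm_coord v (tag x).
    by rewrite /v l2D l2N l2single_same l2single_diff 1?eq_sym // subr0.
  have hy : to_base d b y <= Num.max M 0.
    rewrite le_max; apply/orP; left; apply: hM; apply: le_trans hv.
    have := l2_norm_coord v (tag y).
    by rewrite /v l2D l2N l2single_same l2single_diff // sub0r normrN.
  by move: hgap hx hy M0; lra.
Qed.

End UnionEmbedding.
End CoarseEmbedding.

(** * Schreier graphs *)

Section GraphDistance.
Variables (R : realType) (V : Type) (adj : V -> V -> Prop).
Hypothesis adj_sym : forall x y, adj x y -> adj y x.

Lemma walk0 x : walk adj 0 x x.
Proof. by exists (fun=> x). Qed.

Lemma walk1 x y : adj x y -> walk adj 1 x y.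
Proof. by move=> xy; exists (fun i => if i is 0%N then x else y); split=> // -[]. Qed.

Lemma walk_cat k l x y z : walk adj k x y -> walk adj l y z ->
  walk adj (k + l) x z.
Proof.
move=> [v [v0 vk hv]] [w [w0 wl hw]].
exists (fun i => if (i <= k)%N then v i else w (i - k)%N); split=> //.
  case: leqP => [|_]; last by rewrite addKn.
  by rewrite -{2}(addn0 k) leq_add2l leqn0 => /eqP l0; rewrite -wl l0 addn0 w0.
move=> i ikl; case: (ltngtP i k) => [ik|ki|ik].
- exact: hv.
- by rewrite subSn ?(ltnW ki) //; apply: hw; lia.
- rewrite ik subSnn vk -w0; apply: hw.
  by move: ikl; rewrite ik -{1}(addn0 k) ltn_add2l.
Qed.

Lemma walk_sym k x y : walk adj k x y -> walk adj k y x.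
Proof.
move=> [v [v0 vk hv]]; exists (fun i => v (k - i)%N).
rewrite subn0 subnn; split=> // i ik; apply: adj_sym.
by have := hv (k - i.+1)%N; rewrite subnSK //; apply; lia.
Qed.

Hypothesis connected : forall x y, exists k, walk adj k x y.

Lemma graph_distP x y : exists k, [/\ graph_dist R adj x y = k%:R,
  walk adj k x y & forall j, walk adj j x y -> (k <= j)%N].
Proof.
have ex : exists k, `[< walk adj k x y >].
  by have [k hk] := connected x y; exists k; apply/asboolP.
case: (ex_minnP ex) => k /asboolP hk kmin; exists k; split=> //; last first.
  by move=> j hj; apply: kmin; apply/asboolP.
apply/eqP; rewrite eq_le; apply/andP; split.
  by apply: ge_inf; [exists 0 => _ [j _ <-]|exists k].
apply: lb_le_inf; first by exists k%:R, k.
by move=> _ [j hj <-]; rewrite ler_nat kmin //; apply/asboolP.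
Qed.

Lemma graph_dist_le k x y : walk adj k x y -> graph_dist R adj x y <= k%:R.
Proof.
have [m [-> _ mmin]] := graph_distP x y.
by move=> /mmin; rewrite ler_nat.
Qed.

Lemma graph_distxx x : graph_dist R adj x x = 0.
Proof.
have [m [-> _ mmin]] := graph_distP x x.
by have := mmin 0%N (walk0 x); rewrite leqn0 => /eqP ->.
Qed.

Lemma graph_dist_eq0 x y : graph_dist R adj x y = 0 -> x = y.
Proof.
have [m [-> [v [v0 vm _]] _]] := graph_distP x y.
by move=> /eqP; rewrite pnatr_eq0 => /eqP m0; rewrite -v0 -vm m0.
Qed.

Lemma graph_distC x y : graph_dist R adj x y = graph_dist R adj y x.
Proof.
have [m [-> hm mmin]] := graph_distP x y; have [l [-> hl lmin]] := graph_distP y x.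
by congr (_%:R); apply/eqP; rewrite eqn_leq mmin ?lmin //; exact: walk_sym.
Qed.

Lemma graph_dist_triangle x y z :
  graph_dist R adj x z <= graph_dist R adj x y + graph_dist R adj y z.
Proof.
have [m [-> hm _]] := graph_distP x y; have [l [-> hl _]] := graph_distP y z.
by rewrite -natrD; apply/graph_dist_le/walk_cat; [exact: hm|exact: hl].
Qed.

End GraphDistance.

Lemma finite_set_bound (R : realType) (T : eqType) (A : set T) (f : T -> R) :
  finite_set A -> exists2 M, 0 <= M & forall x, A x -> f x <= M.
Proof.
move=> /finite_seqP[s ->]; elim: s => [|x s [M M0 hM]]; first by exists 0.
exists (Num.max M (f x)); first by rewrite le_max M0.
move=> y; rewrite /= inE => /orP[/eqP ->|ys]; first by rewrite le_max lexx orbT.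
by rewrite le_max hM.
Qed.

Section Generators.
Variables (G : groupType) (S : set G).
Hypothesis genS : generates S.

Lemma schreier_adj_sym (X : symrep G) (x y : X) :
  schreier_adj S x y -> schreier_adj S y x.
Proof. by move=> [s Ss h]; exists s => //; case: h; [right|left]. Qed.

(** One length serves all points of all [G]-sets: the elements that admit such a length form a
    subgroup containing [S]. *)
Lemma generated_walk g : exists k, forall (X : symrep G) (x : X),
  walk (schreier_adj S (X := X)) k x (sym_act g x).
Proof.
pose P g := exists k, forall (X : symrep G) (x : X),
  walk (schreier_adj S (X := X)) k x (sym_act g x).
have P1 : P 1%g by exists 0%N => X x; rewrite sym_act1; exact: walk0.
have PM g' h : P g' -> P h -> P (g' * h)%g.
  move=> [k hk] [l hl]; exists (l + k)%N => X x; rewrite sym_actM.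
  exact: walk_cat (hl X x) (hk X _).
have PV g' : P g' -> P (g'^-1)%g.
  move=> [k hk]; exists k => X x; apply: walk_sym; first exact: schreier_adj_sym.
  by have := hk X (sym_act g'^-1%g x); rewrite -sym_actM mulgV sym_act1.
apply/(subgroup_ofP P1 PM PV); apply: genS => s Ss; apply/subgroup_ofP.
by exists 1%N => X x; apply: walk1; exists s => //; left.
Qed.

(** Words in [S] and inverses are coded by natural numbers. This turns a family of subgroups indexed
    by [G] into a sequence. *)
Lemma generated_enumeration : finite_set S ->
  exists e : nat -> G, forall g, exists n, e n = g.
Proof.
move=> /finite_seqP[s sS].
pose letter (u : nat * bool) := if u.2 then nth 1%g s u.1 else ((nth 1%g s u.1)^-1)%g.
pose val := foldr (fun u g => letter u * g)%g 1%g.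
have val_cat u v : val (u ++ v) = (val u * val v)%g.
  by elim: u => [|x u IH] /=; rewrite ?mul1g // IH mulgA.
pose P g := exists u, val u = g.
have P1 : P 1%g by exists [::].
have PM g h : P g -> P h -> P (g * h)%g.
  by move=> [u <-] [v <-]; exists (u ++ v); rewrite val_cat.
have PV g : P g -> P (g^-1)%g.
  move=> [u <-]; elim: u => [|[i e] u [v hv]] /=; first by exists [::]; rewrite invg1.
  exists (v ++ [:: (i, ~~ e)]); rewrite val_cat hv /= invgM mulg1.
  by congr (_ * _)%g; rewrite /letter /=; case: e; rewrite /= ?invgK.
exists (fun n => val (odflt [::] (unpickle n))) => g.
have [u <-] : P g.
  apply/(subgroup_ofP P1 PM PV); apply: genS => x; rewrite sS => xs.
  apply/subgroup_ofP; exists [:: (index x s, true)].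
  by rewrite /= mulg1 /letter /= nth_index.
by exists (pickle u); rewrite pickleK.
Qed.

End Generators.

Section Cosets.
Variables (G : groupType) (N : groupClosed G).

Lemma coset_has_rep (C : cosets N) : exists g, val C = left_coset N g.
Proof. by have /set_mem[g _ <-] := valP C; exists g. Qed.

Definition coset_rep (C : cosets N) : G := projT1 (cid (coset_has_rep C)).

Definition coset_of_elt (g : G) : cosets N :=
  exist _ (left_coset N g) (mem_set (ex_intro2 _ _ g I erefl)).

Lemma left_coset_eq g h : (left_coset N g = left_coset N h) <->
  (h^-1 * g)%g \in N.
Proof.
split=> [e|hg].
  have : left_coset N h g by rewrite -e; exists 1%g; rewrite ?mulg1 //= gpred1.
  by move=> [n Nn <-]; rewrite mulKg.
apply/seteqP; split=> x [n Nn <-].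
  exists (h^-1 * g * n)%g; first by rewrite /= gpredM.
  by rewrite -!mulgA mulVKg.
exists ((h^-1 * g)^-1 * n)%g; first by rewrite /= gpredM ?gpredVr.
by rewrite invgM invgK -!mulgA mulVKg.
Qed.

Lemma coset_repP C : val C = left_coset N (coset_rep C).
Proof. by rewrite /coset_rep; case: cid. Qed.

Lemma coset_act_val g C :
  val (coset_act g C) = left_coset N (g * coset_rep C)%g.
Proof.
rewrite /= coset_repP /left_coset image_comp; apply: eq_imagel => x _ /=.
by rewrite mulgA.
Qed.

Lemma coset_act_eq g C D :
  ((coset_rep D)^-1 * (g * coset_rep C))%g \in N -> coset_act g C = D.
Proof.
by move=> h; apply: val_inj; rewrite coset_act_val coset_repP; apply/left_coset_eq.
Qed.

Lemma coset_act_rep g C : exists2 n, n \in N &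
  coset_rep (coset_act g C) = (g * coset_rep C * n)%g.
Proof.
exists ((g * coset_rep C)^-1 * coset_rep (coset_act g C))%g; last by rewrite mulVKg.
by apply/left_coset_eq; rewrite -coset_repP coset_act_val.
Qed.

End Cosets.

Lemma coset_act_transitive (G : groupType) (N : groupClosed G) (C D : cosets N) :
  exists g, coset_act g C = D.
Proof.
exists (coset_rep D * (coset_rep C)^-1)%g; apply: coset_act_eq.
by rewrite mulgVK mulVg gpred1.
Qed.

Section SchreierGraphs.
Variables (R : realType) (G : groupType) (S : set G).
Hypotheses (finS : finite_set S) (genS : generates S).
Variables (W : normedModType R) (q : inner W) (u : W).
Hypotheses (W_complete : cauchy_complete W) (qE : forall w, q w w = `|w| ^+ 2).
Hypothesis u1 : `|u| = 1.
Variables (N : nat -> groupClosed G) (F : nat -> G -> W).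
Hypothesis family : coarse_family N F.

Let X n := irr_symrep (N n).
Let d n : X n -> X n -> R := @schreier_dist R G S (X n).
Let connected n (C D : X n) : exists k, walk (schreier_adj S (X := X n)) k C D.
Proof.
have [g <-] := coset_act_transitive C D.
by have [k hk] := generated_walk genS g; exists k; exact: hk.
Qed.
Let b n : X n := coset_of_elt (N n) 1%g.
Let f n (C : X n) : W := F n (coset_rep C).

(** The value at a coset is read off at a chosen representative; right invariance under [N n] allows
    any other. *)
Let f_act n g (C : X n) : f (sym_act g C) = F n (g * coset_rep C)%g.
Proof.
have [_ inv _ _] := family; rewrite /f /=.
by have [m Nm ->] := coset_act_rep g C; exact: inv.
Qed.

Lemma schreier_embeds : exists Y : metricType R,
  coarse_disjoint_union (fun n => @schreier_dist R G S (irr_symrep (N n))) Y /\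
  embeds_in_hilbert Y.
Proof.
have [fin inv up low] := family.
have dxx n (C : X n) : d C C = 0 by apply: graph_distxx; exact: connected.
have d_eq0 n (C D : X n) : d C D = 0 -> C = D.
  by apply: graph_dist_eq0; exact: connected.
have dC n (C D : X n) : d C D = d D C.
  by apply: graph_distC; [exact: schreier_adj_sym|exact: connected].
have d_tri n (C D E : X n) : d C E <= d C D + d D E.
  by apply: graph_dist_triangle; exact: connected.
have d_bounded n : exists M, forall C : X n, d C (b n) <= M.
  (* [h] extends the distance to the base point by 0 to all sets, so that it can be bounded on the
     finite set of cosets. *)
  pose h (A : set G) : R := if pselect (A \in range (left_coset (N n))) is left hA
    then d (exist _ A hA : X n) (b n) else 0.
  have [M _ hM] := finite_set_bound h (fin n); exists M => C.
  have := hM (val C) (set_mem (valP C)); rewrite /h; case: pselect => [hC|].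
    by have -> : exist _ (val C) hC = C :> X n by exact: val_inj.
  by case; exact: (valP C).
exists (union_metric b dxx d_eq0 dC d_tri); split; first exact: union_is_coarse.
pose beta s := projT1 (cid (up s)).
have hbeta s n g : `|F n (s * g)%g - F n g| <= beta s.
  by rewrite /beta; case: cid.
(* [C] bounds the displacement by each generator, so [f] is [C]-Lipschitz along walks. *)
have [C C0 hC] := finite_set_bound beta finS.
apply: (@union_embeds _ _ _ W_complete qE _ u1 _ _ _ _ _ _ _ f C C0).
- move=> n x y; have [k [dk hk _]] := graph_distP R (@connected n) x y.
  rewrite [d x y]dk; case: hk {dk} => v [<- <- hv]; elim: k hv => [|k IH] hv.
    by rewrite subrr normr0 mulr0.
  rewrite -natr1 mulrDr mulr1; apply: le_trans (ler_distD (f (v k)) _ _) _.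
  apply: lerD; first by apply: IH => i ik; apply: hv; exact: ltnW.
  case: (hv k (ltnSn k)) => s Ss [->|->]; rewrite f_act.
    by rewrite distrC; apply: le_trans (hC s Ss); exact: hbeta.
  by apply: le_trans (hC s Ss); exact: hbeta.
- move=> r; have [D fD hD] := low r.
  (* Points with images within [r] differ by an element of the finite set [D], and each element of
     [D] is realized by walks of one length in all components. *)
  pose len g := projT1 (cid (generated_walk genS g)).
  have hlen g n (x : X n) : walk (schreier_adj S (X := X n)) (len g) x (sym_act g x).
    exact: (projT2 (cid (generated_walk genS g)) (X n) x).
  have [M _ hM] := finite_set_bound (fun g => (len g)%:R : R) fD.
  exists M => n x y /hD[e De he]; apply: le_trans (hM e De).
  apply: graph_dist_le; first exact: connected.
  by have := hlen e n x; rewrite /= (coset_act_eq he).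
Qed.

End SchreierGraphs.

Theorem proposition1 (R : realType) (A B G : groupType)
    (iA : {multiplicative A -> G}) (iB : {multiplicative B -> G})
    (hA : finitely_generated A) (hB : finitely_generated B)
    (rA : residually_finite A) (rB : residually_finite B)
    (hG : is_free_product iA iB)
    (S : set G) (finS : finite_set S) (genS : generates S)
    (boxA : exists X : metricType R, is_box_space A X /\ embeds_in_hilbert X)
    (boxB : exists X : metricType R, is_box_space B X /\ embeds_in_hilbert X) :
  exists N : nat -> groupClosed G,
    [/\ forall n, finite_index (N n),
        trivial_intersection N &
        exists X : metricType R,
          coarse_disjoint_union
            (fun n => @schreier_dist R G S (irr_symrep (N n))) X /\
          embeds_in_hilbert X].
Proof.
have [XA [bA eA]] := boxA; have [XB [bB eB]] := boxB.
have [W [q [u [qE W_complete u1 [N [F [[fin inv up low] N1]]]]]]] :=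
  free_product_maps hG (box_space_maps bA eA) (box_space_maps bB eB).
have [e he] := generated_enumeration genS finS.
exists (fun n => N (e n)); split=> //.
  (* If [e n = g], the subgroup of index [n] is the one chosen to avoid [g]. *)
  move=> g hg; apply: contrapT => /N1; have [n en] := he g.
  by rewrite -{2}en hg.
apply: (schreier_embeds finS genS W_complete qE u1 (F := fun n => F (e n))).
split=> //.
- by move=> n g h; exact: inv.
- by move=> s; have [c hc] := up s; exists c => n; exact: hc.
- by move=> r; have [D fD hD] := low r; exists D => // n; exact: hD.
Qed.
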